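(* Let $n \ge 9$. There is no algorithm which, given as input a finite set $X$ of matrices in $\mathrm{GL}_n(\mathbb{Q})$, decides whether or not the subgroup $\langle X \rangle$ generated by $X$ contains a non-identity matrix whose upper right corner entry (the $(1,n)$-entry) is zero.
   Context: Matrices are given by their (rational) entries. ''Undecidable'' means that no algorithm (Turing machine) solves the problem for all inputs. *)

(* Defs.v *)
From HB Require Import structures.
From mathcomp Require Import all_boot all_order all_algebra.
Set Implicit Arguments. Unset Strict Implicit. Unset Printing Implicit Defensive.
Import Order.TTheory GRing.Theory Num.Theory.
Local Open Scope ring_scope.

(* A Turing-complete model of computation: Minsky (counter / register)       *)
(* machines over nat.  A program is a list of instructions; the machine      *)
(* halts when the program counter leaves the program.                        *)

Inductive instr : Type :=
  | INC of nat
  | DEC of nat & nat.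

Definition config : Type := (nat * (nat -> nat))%type.

Definition upd (R : nat -> nat) (r v : nat) : nat -> nat :=
  fun s => if s == r then v else R s.

Definition step (p : seq instr) (c : config) : config :=
  let: (pc, R) := c in
  if (pc < size p)%N then
    match nth (INC 0) p pc with
    | INC r => (pc.+1, upd R r (R r).+1)
    | DEC r j => if R r is k.+1 then (pc.+1, upd R r k) else (j, R)
    end
  else c.

Definition run (p : seq instr) (k : nat) (c : config) : config :=
  iter k (step p) c.

Definition init (x : nat) : config := (0%N, fun r => if r == 0%N then x else 0%N).

Definition halts_with (p : seq instr) (x y : nat) : Prop :=
  exists k, (size p <= (run p k (init x)).1)%N /\ (run p k (init x)).2 0%N = y.

(* A decision problem on inputs of a countable type T, restricted to the
   admissible inputs [valid], is decidable if some machine, given the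
   (canonical, computable) nat encoding [pickle] of an admissible input t,
   halts with output 1 if [P t] holds and with output 0 otherwise. *)
Definition machine_decidable (T : countType) (valid : T -> Prop) (P : T -> Prop)
  : Prop :=
  exists p : seq instr, forall t : T, valid t ->
    (P t -> halts_with p (pickle t) 1) /\ (~ P t -> halts_with p (pickle t) 0).

Definition is_GL_subgroup (n : nat) (S : 'M[rat]_n -> Prop) : Prop :=
  [/\ (forall A, S A -> A \in unitmx),
      S 1%:M,
      (forall A B, S A -> S B -> S (A *m B)) &
      (forall A, S A -> S (invmx A))].

Definition in_generated (n : nat) (X : seq 'M[rat]_n) (A : 'M[rat]_n) : Prop :=
  forall S : 'M[rat]_n -> Prop, is_GL_subgroup S -> (forall B, B \in X -> S B) -> S A.

Definition upper_right (n : nat) : 'M[rat]_n -> rat :=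
  match n return 'M[rat]_n -> rat with
  | 0 => fun _ => 0
  | m.+1 => fun A => A ord0 ord_max
  end.

Definition GL_list (n : nat) (X : seq 'M[rat]_n) : Prop :=
  forall A, A \in X -> A \in unitmx.

Definition has_nontrivial_corner_zero (n : nat) (X : seq 'M[rat]_n) : Prop :=
  exists A, in_generated X A /\ A != 1%:M /\ upper_right A = 0.

(* Main.v *)
Require Import Defs.
From mathcomp Require Import all_boot all_order all_algebra.
From HB Require Import structures.
From mathcomp Require Import zify ring lra.
From Stdlib Require Import FunctionalExtensionality ClassicalEpsilon.
Set Implicit Arguments. Unset Strict Implicit. Unset Printing Implicit Defensive.
Import Order.TTheory GRing.Theory Num.Theory.

(** Over the free group F on finitely many parabolic elements of SL_2(Q), let (a, b) act on
    M_2(Q) by X |-> b^-1 X a. Since no nontrivial element of F fixes the point at infinity, the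
    (1,0)-entry of b^-1 a vanishes iff a = b, so padding this action suitably turns the question
    into: does a finitely generated subgroup G of F x F contain a pair (a, a) with a <> 1?

    A counter machine acts on integers (registers are exponents of primes) by finitely many
    partial maps c + m u |-> d + n u. Encode the configuration (i, z) by the conjugate of t_i by
    x^z; a letter r conjugating x^m to x^n and the conjugate of t_i by x^c to that of t_j by x^d
    simulates one such map. As in Mikhailova's construction, G is generated by the pairs (s, s') of
    a letter and its primed copy together with (w, 1) for these relators w. Adding the relators
    saying that f commutes with the halting letter and all r, and the pair (f, t' f t'^-1), where
    t' encodes the initial configuration, makes (f, f) an element of G if the machine halts.
    Otherwise an explicit action, in which t_i fixes a point of a line iff the corresponding
    configuration halts, shows that every pair (a, a) of G is trivial.

    The input x enters through a single matrix, whose entries are affine in 2^x. Hence a decision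
    machine p yields a machine M that, on any input x, prepends this matrix to the list of matrices
    coded by x, runs p on the result and halts iff p answers no. Run on the code of the other
    matrices of the instance built from M itself, M halts iff p claims that it does not. *)

(** * Programming counter machines *)

Definition reaches (p : seq instr) (c c' : config) : Prop := exists k, run p k c = c'.

Definition halts_on (p : seq instr) (x : nat) : Prop :=
  exists k, size p <= (run p k (init x)).1.

Lemma reaches_refl p c : reaches p c c.
Proof. by exists 0. Qed.

Lemma reaches_eq p o o' R R' : o = o' -> R =1 R' -> reaches p (o, R) (o', R').
Proof. by move=> -> /functional_extensionality ->; apply: reaches_refl. Qed.

Lemma reaches_trans p c2 c1 c3 : reaches p c1 c2 -> reaches p c2 c3 -> reaches p c1 c3.
Proof. by case=> k <- [l <-]; exists (l + k); rewrite /run iterD. Qed.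

Lemma reaches_step p c c' : reaches p (step p c) c' -> reaches p c c'.
Proof. by case=> k <-; exists k.+1; rewrite /run iterSr. Qed.

Definition code_at (p : seq instr) (o : nat) (l : seq instr) : Prop :=
  exists u v, p = u ++ l ++ v /\ size u = o.

Lemma code_at_cat p o l1 l2 :
  code_at p o (l1 ++ l2) -> code_at p o l1 /\ code_at p (o + size l1) l2.
Proof.
case=> u [v [-> <-]]; split; first by exists u, (l2 ++ v); rewrite !catA.
by exists (u ++ l1), v; rewrite size_cat !catA.
Qed.

Lemma code_at_cons p o i l :
  code_at p o (i :: l) -> [/\ o < size p, nth (INC 0) p o = i & code_at p o.+1 l].
Proof.
case=> u [v [-> <-]]; split; first by rewrite !size_cat /=; lia.
  by rewrite nth_cat ltnn subnn.
by exists (rcons u i), v; rewrite size_rcons cat_rcons.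
Qed.

Lemma step_INC p o r l R :
  code_at p o (INC r :: l) -> step p (o, R) = (o.+1, upd R r (R r).+1).
Proof. by case/code_at_cons=> h e _; rewrite /step h e. Qed.

Lemma step_DEC p o r j l R :
  code_at p o (DEC r j :: l) ->
  step p (o, R) = if R r is k.+1 then (o.+1, upd R r k) else (j, R).
Proof. by case/code_at_cons=> h e _; rewrite /step h e. Qed.

Ltac eqs := rewrite /upd /=; repeat case: eqP => /=; intros; subst; try lia.
Ltac regs := move=> ?; eqs.

(* Register 1 always holds 0 while expressions are evaluated, so [DEC 1 o] is an
   unconditional jump. *)
Definition move_code (s d o : nat) : seq instr := [:: DEC s (o + 3); INC d; DEC 1 o].

Lemma move_codeP p o s d R : code_at p o (move_code s d o) ->
  s != d -> s != 1 -> d != 1 -> R 1 = 0 ->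
  reaches p (o, R) (o + 3, upd (upd R d (R d + R s)) s 0).
Proof.
move=> h sd s1 d1; move Es: (R s) => k; elim: k R Es => [|k IH] R Es R1.
  apply: reaches_step; rewrite (step_DEC _ h) Es.
  by apply: reaches_eq => //; regs.
have [_ _ h1] := code_at_cons h; have [_ _ h2] := code_at_cons h1.
apply: reaches_step; rewrite (step_DEC _ h) Es.
apply: reaches_step; rewrite (step_INC _ h1).
apply: reaches_step; rewrite (step_DEC _ h2).
have -> : upd (upd R s k) d (upd R s k d).+1 1 = 0.
  by eqs.
set R' := upd _ d _.
apply: reaches_trans (IH _ _ _) _; last by apply: reaches_eq => //; rewrite /R'; regs.
all: by rewrite // /R'; eqs.
Qed.

Definition split_code (s d e o : nat) : seq instr :=
  [:: DEC s (o + 4); INC d; INC e; DEC 1 o].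

Lemma split_codeP p o s d e R : code_at p o (split_code s d e o) ->
  s != d -> s != e -> s != 1 -> d != 1 -> e != 1 -> R 1 = 0 ->
  reaches p (o, R)
    (o + 4, upd (let R' := upd R d (R d + R s) in upd R' e (R' e + R s)) s 0).
Proof.
move=> h sd se s1 d1 e1; move Es: (R s) => k; elim: k R Es => [|k IH] R Es R1.
  apply: reaches_step; rewrite (step_DEC _ h) Es.
  by apply: reaches_eq => //; regs.
have [_ _ h1] := code_at_cons h; have [_ _ h2] := code_at_cons h1.
have [_ _ h3] := code_at_cons h2.
apply: reaches_step; rewrite (step_DEC _ h) Es.
apply: reaches_step; rewrite (step_INC _ h1).
apply: reaches_step; rewrite (step_INC _ h2).
apply: reaches_step; rewrite (step_DEC _ h3).
set R' := upd _ e _.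
have R'1 : R' 1 = 0.
  by rewrite /R'; eqs.
rewrite R'1.
apply: reaches_trans (IH _ _ _) _; last by apply: reaches_eq => //; rewrite /R'; regs.
all: by rewrite // /R'; eqs.
Qed.

(** With both targets of the split equal, [e] receives twice the value of [d], which is then moved
    back. *)
Definition double_code (d e o : nat) : seq instr :=
  split_code d e e o ++ move_code e d (o + 4).

Lemma double_codeP p o d e R : code_at p o (double_code d e o) ->
  d != e -> d != 1 -> e != 1 -> R 1 = 0 -> R e = 0 ->
  reaches p (o, R) (o + 7, upd R d (R d).*2).
Proof.
case/code_at_cat=> h1 h2 de d1 e1 R1 Re.
apply: reaches_trans (split_codeP h1 _ _ _ _ _ R1) _ => //.
apply: reaches_trans (move_codeP h2 _ _ _ _) _; try by eqs.
by apply: reaches_eq; [rewrite /=; lia | regs].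
Qed.

(** [Pow2Odd] is the operation by which [CodeSeq.code] puts a head in front of an encoded list, so
    these expressions can build pickles. *)
Inductive expr : Type :=
  | Zero
  | Inp
  | Succ of expr
  | Add of expr & expr
  | Pow2Odd of expr & expr.

Fixpoint eval_expr (e : expr) (x : nat) : nat :=
  match e with
  | Zero => 0
  | Inp => x
  | Succ e => (eval_expr e x).+1
  | Add a b => eval_expr a x + eval_expr b x
  | Pow2Odd a b => 2 ^ eval_expr a x * (eval_expr b x).*2.+1
  end.

(* [compile e d o], loaded at address [o], writes the value of [e] at the contents of register 0
   to register [d], using the registers above [d] as scratch. *)
Fixpoint compile (e : expr) (d o : nat) : seq instr :=
  match e with
  | Zero => [::]
  | Inp => split_code 0 d d.+1 o ++ move_code d.+1 0 (o + 4)
  | Succ a => compile a d o ++ [:: INC d]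
  | Add a b =>
      let ca := compile a d o in
      let cb := compile b d.+1 (o + size ca) in
      ca ++ cb ++ move_code d.+1 d (o + size ca + size cb)
  | Pow2Odd a b =>
      let cb := compile b d o in
      let o1 := o + size cb in
      let ca := compile a d.+1 (o1 + 8) in
      let o2 := o1 + 8 + size ca in
      cb ++ (double_code d d.+1 o1 ++ [:: INC d]) ++ ca ++
      DEC d.+1 (o2 + 9) :: (double_code d d.+2 o2.+1 ++ [:: DEC 1 o2])
  end.

Lemma double_loopP p o d R :
  code_at p o (DEC d.+1 (o + 9) :: (double_code d d.+2 o.+1 ++ [:: DEC 1 o])) ->
  1 < d -> R 1 = 0 -> R d.+2 = 0 ->
  reaches p (o, R) (o + 9, upd (upd R d (2 ^ R d.+1 * R d)) d.+1 0).
Proof.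
move=> h d1; move Es: (R d.+1) => k; elim: k R Es => [|k IH] R Es R1 Rd.
  apply: reaches_step; rewrite (step_DEC _ h) Es.
  by apply: reaches_eq => //; regs; rewrite ?mul1n; lia.
have [_ _ h1] := code_at_cons h; have [h2 h3] := code_at_cat h1.
apply: reaches_step; rewrite (step_DEC _ h) Es.
apply: reaches_trans (double_codeP h2 _ _ _ _ _) _; try by eqs.
have h4 : code_at p (o + 8) [:: DEC 1 o] by move: h3; congr code_at; rewrite /=; lia.
rewrite (_ : o.+1 + 7 = o + 8); last by lia.
apply: reaches_step; rewrite (step_DEC _ h4).
set R' := upd _ d _.
have R'1 : R' 1 = 0 by rewrite /R'; eqs.
rewrite R'1; apply: reaches_trans (IH _ _ _ _) _; last first.
  by apply: reaches_eq => //; rewrite /R'; regs; rewrite expnS; lia.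
all: by rewrite // /R'; eqs.
Qed.

(** Induction on the expression. The scratch registers return to 0, and register 0, emptied while
    being copied, is refilled; the next subexpression relies on both. *)
Lemma compileP e d o p R : code_at p o (compile e d o) -> 1 < d -> R 1 = 0 ->
  (forall r, d <= r -> R r = 0) ->
  reaches p (o, R) (o + size (compile e d o), upd R d (eval_expr e (R 0))).
Proof.
elim: e d o R => [||a IHa|a IHa b IHb|a IHa b IHb] d o R;
  cbn [compile eval_expr] => h d1 R1 Rd.
- apply: reaches_eq => [|r]; first by rewrite /=; lia.
  by have := Rd _ (leqnn _); rewrite /upd; case: eqP => // ->.
- have [h1 h2] := code_at_cat h.
  apply: reaches_trans (split_codeP h1 _ _ _ _ _ _) _; try lia.
  apply: reaches_trans (move_codeP h2 _ _ _ _) _ => //; try lia.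
    by eqs.
  have e1 := Rd d (leqnn _); have e2 := Rd d.+1 (leqnSn _).
  by apply: reaches_eq; [rewrite /=; lia | regs].
- have [h1 h2] := code_at_cat h.
  apply: reaches_trans (IHa _ _ _ h1 d1 R1 Rd) _.
  apply: reaches_step; rewrite (step_INC _ h2) size_cat /=.
  by apply: reaches_eq; [lia | regs].
- have [h1 h'] := code_at_cat h; have [h2 h3] := code_at_cat h'.
  apply: reaches_trans (IHa _ _ _ h1 d1 R1 Rd) _.
  apply: reaches_trans (IHb _ _ _ h2 _ _ _) _; try lia.
  + by eqs.
  + by move=> r hr; rewrite /upd; case: eqP => ?; [lia | apply: Rd; lia].
  apply: reaches_trans (move_codeP h3 _ _ _ _) _; try lia.
    by eqs.
  have e2 := Rd d.+1 (leqnSn _).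
  by apply: reaches_eq; [rewrite !size_cat /=; lia | regs].
- have [h1 h'] := code_at_cat h; have [h2 h''] := code_at_cat h'.
  have [h3 h4] := code_at_cat h''.
  have e1 := Rd d (leqnn _); have e2 := Rd d.+1 (leqnSn _).
  have e3 : R d.+2 = 0 by apply: Rd; lia.
  have e4 : R d.+3 = 0 by apply: Rd; lia.
  apply: reaches_trans (IHb _ _ _ h1 d1 R1 Rd) _.
  set o1 := o + size (compile b d o) in h2 h3 h4 h *.
  have [h21 h22] := code_at_cat h2.
  apply: reaches_trans (double_codeP h21 _ _ _ _ _) _;
    try by eqs.
  apply: reaches_step; rewrite (step_INC _ h22).
  have {}h3 : code_at p (o1 + 7).+1 (compile a d.+1 (o1 + 8)).
    by move: h3; congr code_at; rewrite /=; lia.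
  have e8 : o1 + 8 = (o1 + 7).+1 by lia.
  rewrite e8 in h3 h4 *.
  apply: reaches_trans (IHa _ _ _ h3 _ _ _) _; try lia.
  + by eqs.
  + by move=> r hr; rewrite /upd; repeat case: eqP => ?; try lia; apply: Rd; lia.
  set o2 := (o1 + 7).+1 + _ in h4 *.
  have {}h4 : code_at p o2 (DEC d.+1 (o2 + 9) :: (double_code d d.+2 o2.+1 ++ [:: DEC 1 o2])).
    by move: h4; congr code_at; rewrite /o2 /o1 /=; lia.
  apply: reaches_trans (double_loopP h4 d1 _ _) _;
    try by eqs.
  apply: reaches_eq; first by rewrite !(size_cat, size_cat) /= ?size_cat /= /o2 /o1; lia.
  by regs.
Qed.

(** * Running a given machine on a computed value *)

Definition clear_code (r o : nat) : seq instr := [:: DEC r (o + 2); DEC 1 o].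

Lemma clear_codeP p o r R : code_at p o (clear_code r o) -> r != 1 -> R 1 = 0 ->
  reaches p (o, R) (o + 2, upd R r 0).
Proof.
move=> h r1; move Er: (R r) => k; elim: k R Er => [|k IH] R Er R1.
  apply: reaches_step; rewrite (step_DEC _ h) Er.
  by apply: reaches_eq => //; regs.
have [_ _ h1] := code_at_cons h.
apply: reaches_step; rewrite (step_DEC _ h) Er.
apply: reaches_step; rewrite (step_DEC _ h1).
have R'1 : upd R r k 1 = 0 by eqs.
rewrite R'1; apply: reaches_trans (IH _ _ _) _; try by eqs.
by apply: reaches_eq => //; regs.
Qed.

(** Every jump out of the program leads to the address just after its relocated copy, so halting
    becomes a transfer of control. *)
Definition shift_instr (o l : nat) (i : instr) : instr :=
  match i with
  | INC r => INC r
  | DEC r j => DEC r (o + minn j l)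
  end.

Lemma shift_simulation q p o k c : code_at q o (map (shift_instr o (size p)) p) ->
  reaches q (o + minn c.1 (size p), c.2)
            (o + minn (run p k c).1 (size p), (run p k c).2).
Proof.
move=> h; elim: k => [|k IH]; first exact: reaches_refl.
apply: reaches_trans IH _; rewrite [run p k.+1 c]/run iterS -/(run p k c).
case: (run p k c) => pc R; rewrite /step; case: ltnP => hpc; last first.
  by rewrite (minn_idPr hpc); exact: reaches_refl.
have : code_at q (o + pc) (drop pc (map (shift_instr o (size p)) p)).
  move: h; rewrite -{1}(cat_take_drop pc (map (shift_instr _ _) p)) => /code_at_cat[_].
  by rewrite size_takel // size_map ltnW.
rewrite (drop_nth (INC 0)) ?size_map // (nth_map (INC 0)) //= => hi.
apply: reaches_step.
case: (nth _ _ _) hi => [r|r j] hi.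
  by rewrite (step_INC _ hi); apply: reaches_eq => //=; lia.
by rewrite (step_DEC _ hi); case: (R r) => [|?]; apply: reaches_eq => //=; lia.
Qed.

Lemma halted_stable p k l c : size p <= (run p k c).1 -> k <= l -> run p l c = run p k c.
Proof.
move=> h /subnKC <-; rewrite addnC /run iterD -/(run p k c).
elim: (l - k) => //= n ->; move: h; case: (run p k c) => pc R /=.
by rewrite ltnNge => ->.
Qed.

(** A halted configuration and the fixed point [c'] both persist, so they would coincide at a late
    common time. *)
Lemma loop_not_halted p k c c' : reaches p c c' -> step p c' = c' -> c'.1 < size p ->
  (run p k c).1 < size p.
Proof.
case=> l hl hs lt; rewrite ltnNge; apply/negP => hk.
have e : forall n, run p (n + l) c = c'.
  by elim=> // n IH; rewrite addSn /run iterS -/(run p _ c) IH.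
have := halted_stable hk (leq_addr l k); rewrite e => e'.
by move: hk; rewrite -e' leqNgt lt.
Qed.

(* On input x: evaluate e at x, run p on the value, then halt iff p has output 0. *)
Definition negated_machine (e : expr) (p : seq instr) : seq instr :=
  let c := compile e 2 0 in
  let o := size c + 5 in
  let o' := o + size p in
  c ++ clear_code 0 (size c) ++ move_code 2 0 (size c + 2) ++
  map (shift_instr o (size p)) p ++ [:: DEC 0 (o' + 2); DEC 0 o'.+1].

(** These instructions read the output of [p] in register 0. On 0 the first jumps past the end; on 1
    it clears the register and the second jumps to itself forever. *)
Lemma negated_machine_tail e p :
  let q := negated_machine e p in
  code_at q (size q - 2) [:: DEC 0 (size q); DEC 0 (size q).-1].
Proof.
set q := negated_machine e p; move=> /=.
have sq : size q = size (compile e 2 0) + 5 + size p + 2.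
  by rewrite /q /negated_machine !size_cat size_map /=; lia.
rewrite sq addnK addn2 /=; set o := _ + size p.
set u := compile e 2 0 ++ clear_code 0 (size (compile e 2 0)) ++
  move_code 2 0 (size (compile e 2 0) + 2) ++
  map (shift_instr (size (compile e 2 0) + 5) (size p)) p.
exists u, [::]; rewrite cats0 /u; split; last by rewrite !size_cat size_map /= /o; lia.
rewrite /q /negated_machine -!catA; do 4! congr (_ ++ _).
by congr [:: DEC _ _; DEC _ _]; rewrite /o; lia.
Qed.

Lemma negated_machineP e p x y : halts_with p (eval_expr e x) y ->
  let q := negated_machine e p in
  exists R, [/\ R 0 = y & reaches q (init x) (size q - 2, R)].
Proof.
move=> [k [hk <-]] q; set R' := (run p k _).2; exists R'; split=> //.
have : code_at q 0 q by exists [::], [::]; rewrite cats0.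
rewrite {2}/q /negated_machine => /code_at_cat [h0] /code_at_cat [h1] /code_at_cat [h2].
case/code_at_cat => h3 _; rewrite !add0n in h1 h2 h3.
apply: reaches_trans (compileP h0 _ _ _) _ => //; first by case.
rewrite add0n; apply: reaches_trans (clear_codeP h1 _ _) _ => //.
apply: reaches_trans (move_codeP h2 _ _ _ _) _ => //.
have := @shift_simulation q p (size (compile e 2 0) + 5) k (init (eval_expr e x)).
rewrite (minn_idPr hk) min0n addn0; set R1 := upd _ 2 0.
have e1 : init (eval_expr e x) = (0, R1).
  by congr pair; apply: functional_extensionality; rewrite /R1; regs.
rewrite /R' e1 => h; apply: reaches_trans (reaches_trans (h _) _).
- by apply: reaches_eq => //=; lia.
- by move: h3; congr code_at; rewrite /=; lia.
- by apply: reaches_eq => //; rewrite /q /negated_machine !size_cat size_map /=; lia.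
Qed.

Lemma negated_machine_halts e p x :
  halts_with p (eval_expr e x) 0 -> halts_on (negated_machine e p) x.
Proof.
case/negated_machineP; set q := negated_machine e p => R [R0 h].
suff [k hk] : reaches q (init x) (size q, R) by exists k; rewrite hk.
apply: reaches_trans h _; apply: reaches_step.
have hs := negated_machine_tail e p; rewrite -/q in hs.
by rewrite (step_DEC _ hs) R0; apply: reaches_refl.
Qed.

Lemma negated_machine_loops e p x :
  halts_with p (eval_expr e x) 1 -> ~ halts_on (negated_machine e p) x.
Proof.
case/negated_machineP; set q := negated_machine e p => R [R0 h] [k].
have hs := negated_machine_tail e p; rewrite -/q in hs.
have [_ _ hs'] := code_at_cons hs; have [lt _ _] := code_at_cons hs'.
rewrite leqNgt => /negP; apply; apply: loop_not_halted.
- apply: reaches_trans h _; apply: reaches_step; rewrite (step_DEC _ hs) R0; exact: reaches_refl.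
- by rewrite (step_DEC _ hs') /upd /=; congr pair; lia.
- by rewrite /=; lia.
Qed.

(** * Computing encodings of matrices *)

Definition expressible (g : nat -> nat) : Prop := exists e, forall x, eval_expr e x = g x.

Lemma eq_expressible g h : g =1 h -> expressible g -> expressible h.
Proof. by move=> gh [e He]; exists e => x; rewrite He gh. Qed.

Lemma expressible_id : expressible id.
Proof. by exists Inp. Qed.

Lemma expressible_const c : expressible (fun=> c).
Proof.
elim: c => [|c [e He]]; first by exists Zero.
by exists (Succ e) => x /=; rewrite He.
Qed.

Lemma expressible_add g h : expressible g -> expressible h ->
  expressible (fun x => g x + h x).
Proof. by move=> [a Ha] [b Hb]; exists (Add a b) => x /=; rewrite Ha Hb. Qed.

Lemma expressible_mulc c g : expressible g -> expressible (fun x => c * g x).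
Proof.
move=> Hg; elim: c => [|c IH]; first by apply: eq_expressible (expressible_const 0).
by apply: eq_expressible (expressible_add Hg IH) => x; rewrite mulSn.
Qed.

Lemma expressible_code_cons g h : expressible g -> expressible h ->
  expressible (fun x => 2 ^ g x * (h x).*2.+1).
Proof. by move=> [a Ha] [b Hb]; exists (Pow2Odd a b) => x /=; rewrite Ha Hb. Qed.

Lemma expressible_pow2 g : expressible g -> expressible (fun x => 2 ^ g x).
Proof.
move=> Hg; apply: eq_expressible (expressible_code_cons Hg (expressible_const 0)) => x.
by rewrite muln1.
Qed.

Lemma expressible_code (I : eqType) (s : seq I) (g : I -> nat -> nat) :
  (forall i, i \in s -> expressible (g i)) ->
  expressible (fun x => CodeSeq.code [seq g i x | i <- s]).
Proof.
elim: s => [|i s IH] Hg; first exact: expressible_const 0.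
apply: (@expressible_code_cons (g i) (fun x => CodeSeq.code [seq g j x | j <- s])).
  by apply: Hg; rewrite mem_head.
by apply: IH => j js; apply: Hg; rewrite inE js orbT.
Qed.

Local Open Scope ring_scope.

Lemma valq_nat (k : nat) : valq k%:R = (k%:Z, 1).
Proof.
apply: (@etrans _ _ (numq k%:R, denq k%:R)); first by rewrite /numq /denq; case: valq.
by rewrite pmulrn numq_int denq_int.
Qed.

(** The encodings of integers and rationals unfold to nested list codes; for a natural number the
    denominator is the constant 1. *)
Lemma expressible_pickle_rat g : expressible g ->
  expressible (fun x => pickle ((g x)%:R : rat)).
Proof.
move=> Hg.
have Hz : expressible (fun x => pickle ((g x)%:Z)).
  apply: (@eq_expressible (fun x =>
    CodeSeq.code [:: CodeSeq.code [:: g x]; CodeSeq.code [::]])) => //.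
  apply: expressible_code_cons; last exact: expressible_const.
  by apply: expressible_code_cons; last exact: expressible_const.
apply: (@eq_expressible (fun x => CodeSeq.code [:: pickle (g x)%:Z; pickle (1 : int)])) => [x|].
  by rewrite -[RHS]/(pickle (valq (g x)%:R)) valq_nat.
apply: expressible_code_cons => //.
by apply: (@expressible_code_cons (fun=> pickle (1 : int)) (fun=> 0%N)); apply: expressible_const.
Qed.

(** Natural coefficients keep the values in the natural numbers, where expressions can compute the
    encoding without subtraction or division. *)
Definition nat_affine (g : nat -> rat) : Prop :=
  exists c d : nat, forall k, g k = (c + d * k)%:R.

Lemma expressible_pickle_matrix n (B : nat -> 'M[rat]_n) g :
  (forall i j, nat_affine (fun k => B k i j)) -> expressible g ->
  expressible (fun x => pickle (B (g x))).
Proof.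
move=> Baff Hg.
(* A matrix is pickled as the list of its entries, each paired with its position. *)
have pickleE x : CodeSeq.code [seq CodeSeq.code [:: pickle ij; pickle (B (g x) ij.1 ij.2)] |
      ij <- enum (('I_n * 'I_n)%type : finType)] = pickle (B (g x)).
  rewrite -[RHS]/(CodeSeq.code [seq pickle i | i <- codom (total_fun (mx_val (B (g x))))]).
  congr CodeSeq.code; rewrite /codom /image_mem -[RHS]map_comp; apply: eq_map => -[i j] /=.
  by rewrite /total_fun /fun_of_matrix; case: (B (g x)).
apply: eq_expressible pickleE _.
apply: expressible_code => -[i j] _.
apply: expressible_code_cons; first exact: expressible_const.
apply: expressible_code_cons; last exact: expressible_const.
have [c [d Hcd]] := Baff i j.
apply: (@eq_expressible (fun x => pickle ((c + d * g x)%:R : rat))) => [x|].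
  by rewrite /= Hcd.
apply: expressible_pickle_rat; apply: expressible_add; first exact: expressible_const.
exact: expressible_mulc.
Qed.

(** The input [pickle F] serves twice, as the tail of the new list and as the parameter of its head.
    This is the self-reference of the diagonal argument. *)
Lemma expressible_pickle_cons n (B : nat -> 'M[rat]_n) :
  (forall i j, nat_affine (fun k => B k i j)) ->
  exists e, forall F : seq 'M[rat]_n,
    eval_expr e (pickle F) = pickle (B (2 ^ pickle F)%N :: F).
Proof.
move=> /expressible_pickle_matrix /(_ (expressible_pow2 expressible_id)) HB.
have [e He] := expressible_code_cons HB expressible_id.
by exists e => F; rewrite He.
Qed.

Local Close Scope ring_scope.

(** * Counter machines as partial affine maps of the integers *)

(** An increasing sequence of primes starting at 2, so that the input x in register 0 becomes the
    integer 2^x. *)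
Definition reg_prime (r : nat) : nat := iter r (fun n => s2val (prime_above n)) 2.

Lemma reg_prime_prime r : prime (reg_prime r).
Proof. by case: r => //= r; case: prime_above. Qed.

Lemma reg_prime_inj : injective reg_prime.
Proof.
have lt : {homo reg_prime : r s / r < s}.
  by apply: homo_ltn => [y x z|r] /=; [exact: ltn_trans | case: prime_above].
move=> r s e; case: (ltngtP r s) => // /lt; rewrite e ltnn //.
Qed.

(* The registers of a configuration are the exponents of the prime factors of one integer z.
   This makes sense for every integer z, not only for the positive ones. *)
Definition int_step (p : seq instr) (c : nat * int) : nat * int :=
  let: (pc, z) := c in
  if pc < size p then
    match nth (INC 0) p pc with
    | INC r => (pc.+1, (z * (reg_prime r)%:Z)%R)
    | DEC r j => if (reg_prime r %| z)%Z then (pc.+1, (z %/ reg_prime r)%Z)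
                 else (minn j (size p), z)
    end
  else c.

Definition accepts (p : seq instr) (pc : nat) (z : int) : Prop :=
  exists k, size p <= (iter k (int_step p) (pc, z)).1.

Lemma accepts_halted p pc z : size p <= pc -> accepts p pc z.
Proof. by exists 0. Qed.

Lemma accepts_step p pc z :
  accepts p pc z <-> accepts p (int_step p (pc, z)).1 (int_step p (pc, z)).2.
Proof.
rewrite /accepts -surjective_pairing; split=> -[k hk]; last by exists k.+1; rewrite iterSr.
case: k hk => [|k]; last by rewrite iterSr => hk; exists k.
by move=> /= h; exists 0; rewrite /= ltnNge h.
Qed.

Lemma logn_reg_primeM r s N : 0 < N ->
  logn (reg_prime s) (N * reg_prime r) = (s == r) + logn (reg_prime s) N.
Proof.
move=> N0; have pr := reg_prime_prime r; rewrite lognM ?(prime_gt0 pr) // (logn_prime _ pr).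
by rewrite (inj_eq reg_prime_inj) addnC.
Qed.

(** Capping the program counter at [size p] leaves a single halting state, hence finitely many
    states. *)
Lemma int_step_simulates p pc R N :
  0 < N -> (forall r, R r = logn (reg_prime r) N) ->
  let c := step p (pc, R) in
  exists N', [/\ 0 < N', forall r, c.2 r = logn (reg_prime r) N' &
    int_step p (minn pc (size p), N : int) = (minn c.1 (size p), N' : int)].
Proof.
move=> N0 HR; rewrite /step /int_step; case: (ltnP pc (size p)) => hpc /=; last first.
  by exists N; split=> //=; rewrite ltnn (minn_idPr hpc).
rewrite hpc; case: (nth _ p pc) => [r|r j] /=.
  exists (N * reg_prime r); split; first by rewrite muln_gt0 N0 prime_gt0 ?reg_prime_prime.
    move=> s; rewrite logn_reg_primeM // /upd !HR; case: eqP => [->|//].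
    by rewrite add1n.
  by rewrite PoszM (minn_idPl hpc).
have pr := reg_prime_prime r; rewrite HR.
rewrite dvdzE /= -{2}(expn1 (reg_prime r)) pfactor_dvdn //.
case E: (logn _ N) => [|k] /=; first by exists N; split.
have dv : reg_prime r %| N by rewrite -{1}(expn1 (reg_prime r)) pfactor_dvdn // E.
have N'0 : 0 < N %/ reg_prime r by rewrite divn_gt0 ?prime_gt0 // dvdn_leq.
exists (N %/ reg_prime r); split=> //.
  move=> s; have := logn_reg_primeM r s N'0; rewrite divnK // /upd HR.
  by case: eqP => [-> | _ ->]; rewrite ?E // => -[].
by rewrite divz_nat (minn_idPl hpc).
Qed.

Lemma halts_on_accepts p x : halts_on p x <-> accepts p 0 (2 ^ x)%N.
Proof.
have H k : exists N, [/\ 0 < N, forall r, (run p k (init x)).2 r = logn (reg_prime r) N &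
   iter k (int_step p) (0, (2 ^ x)%N : int) = (minn (run p k (init x)).1 (size p), N : int)].
  elim: k => [|k [N [N0 HR IH]]].
    exists (2 ^ x); split; rewrite ?expn_gt0 ?min0n // => r.
    rewrite lognX /= -[2]/(reg_prime 0) (logn_prime _ (reg_prime_prime 0)) (inj_eq reg_prime_inj).
    by case: eqP; rewrite ?muln1 ?muln0.
  have [N' [N'0 HR' e]] := int_step_simulates p (run p k (init x)).1 N0 HR.
  exists N'; rewrite /run !iterS -/(run p k _) IH e; move: HR'.
  by rewrite -surjective_pairing.
by split=> -[k hk]; exists k; have [N [_ _ e]] := H k; move: hk; rewrite e /=; lia.
Qed.

(* The datum ((i, m, c), (j, n, d)) stands for the partial map taking (i, c + (m + 1) u) to
   (j, d + (n + 1) u), for all integers u. *)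
Definition rule : Type := (nat * nat * nat) * (nat * nat * nat).

(** Failure of [DEC] is not one arithmetic progression; it is split into one rule for each nonzero
    residue modulo the prime. Rules store moduli minus one, whence [q]. *)
Definition instr_rules (l i : nat) (ins : instr) : seq rule :=
  match ins with
  | INC r => [:: ((i, 0, 0), (i.+1, (reg_prime r).-1, 0))]
  | DEC r j => let q := (reg_prime r).-1 in
      ((i, q, 0), (i.+1, 0, 0)) ::
      [seq ((i, q, s), (minn j l, q, s)) | s <- iota 1 q]
  end.

(** The first rule adds 1 to the integer at the halting state; it links all halting configurations,
    so that one relation about the halting letter covers them. *)
Definition rules (p : seq instr) : seq rule :=
  ((size p, 0, 0), (size p, 0, 1)) ::
  flatten [seq instr_rules (size p) i (nth (INC 0) p i) | i <- iota 0 (size p)].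

(** The equivalence holds because the machine is deterministic: a rule is one step on its
    progression. For the rule at the halting state both sides accept. *)
Lemma rules_accepts p i m c j n d u : ((i, m, c), (j, n, d)) \in rules p ->
  accepts p i (c%:Z + m.+1%:Z * u)%R <-> accepts p j (d%:Z + n.+1%:Z * u)%R.
Proof.
rewrite inE => /orP[/eqP[-> _ _ -> _ _]|]; first by split=> _; exact: accepts_halted.
case/flatten_mapP=> k; rewrite mem_iota add0n /= => hk.
have pr r : (reg_prime r).-1.+1 = reg_prime r by rewrite prednK ?prime_gt0 ?reg_prime_prime.
have pr0 r : ((reg_prime r)%:Z != 0)%R by have := prime_gt0 (reg_prime_prime r); lia.
case E: (nth _ p k) => [r|r l] /=.
  rewrite inE => /eqP[-> -> -> -> -> ->]; rewrite accepts_step /int_step hk E /= pr.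
  by rewrite !add0r mul1r mulrC.
rewrite inE => /orP[/eqP[-> -> -> -> -> ->]|/mapP[s]].
  rewrite accepts_step /int_step hk E /= pr !add0r mul1r dvdz_mulr //=.
  by rewrite mulKz.
rewrite mem_iota => hs [-> -> -> -> -> ->].
rewrite accepts_step /int_step hk E /= pr.
have -> // : (reg_prime r %| (s%:Z + (reg_prime r)%:Z * u)%R)%Z = false.
by rewrite rpredDr ?dvdz_mulr // dvdzE /= gtnNdvd //; have := pr r; lia.
Qed.

Lemma rules_complete p i (N : nat) : i < size p ->
  exists m c j n d (u : nat), [/\ ((i, m, c), (j, n, d)) \in rules p,
    N = c + m.+1 * u & int_step p (i, N : int) = (j, (d + n.+1 * u)%N : int)].
Proof.
move=> hi.
have mem ins rho : nth (INC 0) p i = ins -> rho \in instr_rules (size p) i ins -> rho \in rules p.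
  move=> e h; rewrite inE; apply/orP; right; apply/flatten_mapP; exists i; last by rewrite e.
  by rewrite mem_iota.
have pr r : (reg_prime r).-1.+1 = reg_prime r by rewrite prednK ?prime_gt0 ?reg_prime_prime.
rewrite /int_step hi; case E: (nth _ p i) => [r|r l] /=.
  do 5! eexists; exists N; split; [apply: mem E _; exact: mem_head | by rewrite add0n mul1n |].
  by rewrite pr add0n PoszM mulrC.
rewrite dvdzE /=; case: (boolP (_ %| _)) => dv.
  do 5! eexists; exists (N %/ reg_prime r); split; [apply: mem E _; exact: mem_head | |].
    by rewrite pr add0n mulnC divnK.
  by rewrite divz_nat add0n mul1n.
exists (reg_prime r).-1, (N %% reg_prime r), (minn l (size p)), (reg_prime r).-1,
  (N %% reg_prime r), (N %/ reg_prime r).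
have e : N = N %% reg_prime r + reg_prime r * (N %/ reg_prime r).
  by rewrite mulnC addnC -divn_eq.
rewrite pr -e; split=> //; apply: mem E _; rewrite inE; apply/orP; right.
apply/mapP; exists (N %% reg_prime r) => //; rewrite mem_iota add1n pr lt0n dv /=.
by rewrite ltn_mod prime_gt0 ?reg_prime_prime.
Qed.

(** * Halting computations in a pair of groups *)

Lemma rules_bounded p i m c j n d :
  ((i, m, c), (j, n, d)) \in rules p -> i <= size p /\ j <= size p.
Proof.
rewrite inE => /orP[/eqP[-> _ _ -> _ _]//|/flatten_mapP[k]].
rewrite mem_iota add0n /= => hk; case: (nth _ p k) => [r|r l] /=.
  by rewrite inE => /eqP[-> _ _ -> _ _]; split=> //; exact: ltnW.
rewrite inE => /orP[/eqP[-> _ _ -> _ _]|/mapP[s _ [-> _ _ -> _ _]]].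
  by split=> //; exact: ltnW.
by rewrite geq_minr ltnW.
Qed.

Section Completeness.

Local Open Scope group_scope.

Variables (gT : groupType) (G : gT -> gT -> Prop).
Hypothesis G1 : G 1 1.
Hypothesis GM : forall a b c d, G a b -> G c d -> G (a * c) (b * d).
Hypothesis GV : forall a b, G a b -> G a^-1 b^-1.

Definition in_dom a := exists b, G a b.
(** The elements a with [G a 1] form a normal subgroup of the first projection [in_dom] of [G]; this
    is congruence modulo that kernel. *)
Definition cong a b := G (a * b^-1) 1.

Lemma in_domM a b : in_dom a -> in_dom b -> in_dom (a * b).
Proof. by move=> [c ac] [d bd]; exists (c * d); exact: GM. Qed.

Lemma in_domV a : in_dom a -> in_dom a^-1.
Proof. by case=> c ac; exists c^-1; exact: GV. Qed.

Lemma in_domX a n : in_dom a -> in_dom (a ^+ n).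
Proof.
move=> da; elim: n => [|n IH]; first by exists 1; rewrite expg0.
by rewrite expgS; exact: in_domM.
Qed.

Lemma in_domJ a b : in_dom a -> in_dom b -> in_dom (a ^ b).
Proof. by move=> da db; apply: in_domM; [exact: in_domV | exact: in_domM]. Qed.

Lemma ker_conj a h : G a 1 -> in_dom h -> G (a ^ h) 1.
Proof.
move=> ka [h' hh']; have -> : 1 = h'^-1 * (1 * h') :> gT by rewrite mul1g mulVg.
by apply: GM; [exact: GV | exact: GM].
Qed.

Lemma ker_conjV a h : G a 1 -> in_dom h -> G (h * a * h^-1) 1.
Proof. by move=> ka /in_domV/(ker_conj ka); rewrite conjgE invgK mulgA. Qed.

Lemma kerM a b : G a 1 -> G b 1 -> G (a * b) 1.
Proof. by move=> ka /(GM ka); rewrite mulg1. Qed.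

Lemma kerV a : G a 1 -> G a^-1 1.
Proof. by move/GV; rewrite invg1. Qed.

Lemma cong_refl a : cong a a.
Proof. by rewrite /cong mulgV. Qed.

Lemma cong_sym a b : cong a b -> cong b a.
Proof. by move/kerV; rewrite /cong invgM invgK. Qed.

Lemma congM a b c d : in_dom b -> cong a b -> cong c d -> cong (a * c) (b * d).
Proof.
move=> db ab cd; have := kerM ab (ker_conjV cd db).
by rewrite /cong invgM !mulgA mulgVK.
Qed.

Lemma congV a b : in_dom b -> cong a b -> cong a^-1 b^-1.
Proof.
move=> db /kerV ab; have := ker_conj ab db.
by rewrite /cong conjgE invgM !invgK !mulgA mulVg mul1g.
Qed.

Lemma congX a b n : in_dom b -> cong a b -> cong (a ^+ n) (b ^+ n).
Proof.
move=> db ab; elim: n => [|n IH]; first by rewrite !expg0; exact: cong_refl.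
by rewrite !expgS; exact: congM.
Qed.

Lemma congJ a b h k : in_dom b -> in_dom k -> cong a b -> cong h k -> cong (a ^ h) (b ^ k).
Proof.
move=> db dk ab hk; apply: congM; [exact: in_domV | exact: congV | exact: congM].
Qed.

Variable f : gT.
Hypothesis dom_f : in_dom f.

(** The centraliser of f modulo the kernel, a subgroup of [in_dom] stable under [cong]. *)
Definition fcomm a := in_dom a /\ G (f * a * f^-1 * a^-1) 1.

Lemma fcommM a b : fcomm a -> fcomm b -> fcomm (a * b).
Proof.
move=> [da ca] [db cb]; split; first exact: in_domM.
have := kerM ca (ker_conjV cb da).
by rewrite invgM !mulgA !mulgVK.
Qed.

Lemma fcommV a : fcomm a -> fcomm a^-1.
Proof.
move=> [da ca]; split; first exact: in_domV.
have := ker_conj (kerV ca) da.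
by rewrite conjgE !invgM !invgK !mulgA mulVg mul1g.
Qed.

Lemma fcomm_cong a b : in_dom a -> cong a b -> fcomm b -> fcomm a.
Proof.
move=> da ab [db cb]; split=> //.
have := kerM (kerM (ker_conjV ab dom_f) cb) (cong_sym ab).
by rewrite !mulgA !mulgVK.
Qed.

Variables (p : seq instr) (N : nat).
Variables (x y x' y' : gT) (t t' : nat -> gT) (r r' : rule -> gT).
Hypotheses (Gx : G x x') (Gy : G y y').
Hypothesis Gt : forall i, i <= size p -> G (t i) (t' i).
Hypothesis Gr : forall rho, rho \in rules p -> G (r rho) (r' rho).
Hypothesis rel_x : forall i m c j n d, let rho := ((i, m, c), (j, n, d)) in
  rho \in rules p -> G (r rho * x ^+ m.+1 * (r rho)^-1 * x ^- n.+1) 1.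
Hypothesis rel_t : forall i m c j n d, let rho := ((i, m, c), (j, n, d)) in
  rho \in rules p -> G (r rho * t i ^ (x ^+ c) * (r rho)^-1 * (t j ^ (x ^+ d))^-1) 1.
Hypothesis rel_ft : G (f * t (size p) * f^-1 * (t (size p))^-1) 1.
Hypothesis rel_fr : forall rho, rho \in rules p -> G (f * r rho * f^-1 * (r rho)^-1) 1.
Hypothesis rel_y : G (x ^+ N.+1 * y^-1) 1.
Hypothesis Gf : G f (f ^ (t' 0 ^ (y' * x'^-1))^-1).

(** Modulo the kernel, conjugation by the inverse of [r rho] takes x^(m+1) to x^(n+1) and the
    conjugate of t_i by x^c to that of t_j by x^d. Conjugating further by the u-th power gives the
    claim. *)
Lemma rule_transport i m c j n d u : let rho := ((i, m, c), (j, n, d)) in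
  rho \in rules p ->
  cong ((t i ^ (x ^+ (c + m.+1 * u))) ^ (r rho)^-1) (t j ^ (x ^+ (d + n.+1 * u))).
Proof.
move=> rho mem; have dx : in_dom x by exists x'.
have [_ hj] := rules_bounded mem; have dt : in_dom (t j) by exists (t' j); exact: Gt.
rewrite !(expgnDr x c, expgnDr x d) (expgnA x m.+1) (expgnA x n.+1) !conjgM conjJg conjXg.
apply: congJ; [by do ?apply: in_domJ; do ?apply: in_domX | by do ?apply: in_domX | | ].
by rewrite /cong conjgE invgK mulgA; exact: rel_t.
apply: congX; first exact: in_domX.
by rewrite /cong conjgE invgK mulgA; exact: rel_x.
Qed.

(** The letter [r rho] itself commutes with f modulo the kernel, so conjugating by it preserves
    [fcomm]. *)
Lemma fcomm_rule i m c j n d u : let rho := ((i, m, c), (j, n, d)) in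
  rho \in rules p ->
  fcomm (t i ^ (x ^+ (c + m.+1 * u))) <-> fcomm (t j ^ (x ^+ (d + n.+1 * u))).
Proof.
move=> rho mem; have dx : in_dom x by exists x'.
have [hi hj] := rules_bounded mem.
have dt k : k <= size p -> in_dom (t k) by exists (t' k); exact: Gt.
have dr : in_dom (r rho) by exists (r' rho); exact: Gr.
have cr : fcomm (r rho) by split=> //; exact: rel_fr.
have E := rule_transport u mem; rewrite -/rho in E.
have dj := in_domJ (dt _ hj) (in_domX (d + n.+1 * u) dx).
have di := in_domJ (dt _ hi) (in_domX (c + m.+1 * u) dx).
split=> h.
  apply: (fcomm_cong dj (cong_sym E)); rewrite conjgE invgK.
  by apply: fcommM cr (fcommM h (fcommV cr)).
have := fcomm_cong (in_domJ di (in_domV dr)) E h.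
rewrite -[X in _ -> fcomm X](conjgKV (r rho)) => h'.
by apply: fcommM (fcommV cr) (fcommM h' cr).
Qed.

Lemma fcomm_accepts i (M : nat) : i <= size p -> accepts p i M -> fcomm (t i ^ (x ^+ M)).
Proof.
move=> + [k]; elim: k i M => [|k IH] i M hi.
  move=> /= hi'; have -> : i = size p by apply/eqP; rewrite eqn_leq hi hi'.
  have mem : ((size p, 0, 0), (size p, 0, 1))%N \in rules p by exact: mem_head.
  (* The rule at the halting state raises the exponent of x by 1, so the relation [rel_ft] at
     exponent 0 spreads to all exponents. *)
  elim: M {hi'} => [|M IHM].
    rewrite expg0 conjg1; split; last exact: rel_ft.
    by exists (t' (size p)); exact: Gt.
  by have := (fcomm_rule M mem).1; rewrite add0n mul1n add1n; apply.
have [hi'|hi'] := ltnP i (size p); last first.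
  move=> _; apply: (IH i M hi) => {IH}; elim: k => //= k; case: (iter _ _ _) => a b /=.
  by rewrite /int_step => h; rewrite ltnNge h.
have [m [c [j [n [d [u [mem -> e]]]]]]] := rules_complete M hi'.
rewrite iterSr e => hk; apply/(fcomm_rule u mem); apply: IH hk.
by have [] := rules_bounded mem.
Qed.

(** Let a be the conjugate of [t 0] by y x^-1, and b its partner. Conjugating the pair [Gf] by (a,
    b) gives (f^a, f). Since y x^-1 is congruent to x^N and the configuration accepts, f^a is
    congruent to f. *)
Lemma completeness : accepts p 0 N -> G f f.
Proof.
move=> /(fcomm_accepts (leq0n _)) Q.
have dx : in_dom x by exists x'. have dy : in_dom y by exists y'.
have Gt0 := Gt (leq0n (size p)); have dt : in_dom (t 0) by exists (t' 0).
have Gtau : G (t 0 ^ (y * x^-1)) (t' 0 ^ (y' * x'^-1)).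
  have Gyx := GM Gy (GV Gx).
  by apply: GM; [exact: GV | exact: GM].
have {Q} [_ Q] : fcomm (t 0 ^ (y * x^-1)).
  apply: fcomm_cong Q; first by exists (t' 0 ^ (y' * x'^-1)).
  apply: congJ => //; [exact: in_domX | exact: cong_refl|].
  apply: cong_sym; rewrite -[x ^+ N](mulgK x) -expgSr.
  by apply: congM => //; exact: cong_refl.
move: Gtau Gf Q; move: (t 0 ^ _) (t' 0 ^ _) => a b Gab Gf' Q.
have h : G (f ^ a) f.
  by rewrite -[X in G _ X](conjgKV b f); apply: GM (GV Gab) (GM Gf' Gab).
have [_ Q'] := fcommV (conj (ex_intro _ b Gab) Q).
have := GM Q' h; rewrite mul1g conjgE invgK !mulgA.
by rewrite mulgK !mulgVK.
Qed.

End Completeness.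

(** * Words and a free group of 2 x 2 matrices *)

Local Open Scope ring_scope.

Definition base : countType := option (option (nat + rule)).
Definition bX : base := None.
Definition bY : base := Some None.
Definition bT (i : nat) : base := Some (Some (inl i)).
Definition bR (rho : rule) : base := Some (Some (inr rho)).

(* [None] is the letter f, [Some (false, b)] the letter b and [Some (true, b)] its primed copy. *)
Definition letter : countType := option (bool * base).
(** The flag [true] marks the letter itself and [false] its inverse. *)
Definition word : Type := seq (letter * bool).

Section Words.

Variables (T : Type) (sem : letter -> bool -> T -> T).

Definition act (w : word) (a : T) : T := foldr (fun l => sem l.1 l.2) a w.

Lemma act_cat v w a : act (v ++ w) a = act v (act w a).
Proof. exact: foldr_cat. Qed.

Definition is_action : Prop := forall l s, cancel (sem l s) (sem l (~~ s)).

Definition winv (w : word) : word := rev [seq (l.1, ~~ l.2) | l <- w].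

Hypothesis semK : is_action.

Lemma act_winvK w : cancel (act w) (act (winv w)).
Proof.
elim: w => // l w IH a; rewrite /winv /= rev_cons -cats1 act_cat /=.
by rewrite semK; exact: IH.
Qed.

Lemma act_winvVK w : cancel (act (winv w)) (act w).
Proof.
elim: w => // l w IH a; rewrite /winv /= rev_cons -cats1 act_cat /= IH.
by rewrite -{1}(negbK l.2) semK.
Qed.

Definition push (l : letter * bool) (w : word) : word :=
  if w is l' :: w' then if l' == (l.1, ~~ l.2) then w' else l :: w else [:: l].

Definition reduce (w : word) : word := foldr push [::] w.

Lemma act_reduce w : act (reduce w) =1 act w.
Proof.
move=> a; elim: w => //= l w <-; case: (reduce w) => //= l' w'.
by case: eqP => //= -> /=; rewrite -{1}(negbK l.2) semK.
Qed.

End Words.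

Definition reduced (w : word) : bool := sorted (fun l l' => l' != (l.1, ~~ l.2)) w.

Lemma reduce_reduced w : reduced (reduce w).
Proof.
elim: w => //= l w; case: (reduce w) => //= l' w'.
by case: ifP => /= [_ /path_sorted | -> ->].
Qed.

(** * Ping-pong for parabolic matrices *)

Definition mx2 (R : Type) (a b c d : R) : 'M[R]_2 :=
  \matrix_(i, j) if i == 0 then if j == 0 then a else b else if j == 0 then c else d.

Lemma mx2_eta (R : Type) (A : 'M[R]_2) : A = mx2 (A 0 0) (A 0 1) (A 1 0) (A 1 1).
Proof.
by apply/matrixP => i j; rewrite mxE; case: i j => [[|[|//]] ?] [[|[|//]] ?];
  rewrite -!val_eqE /=; congr (A _ _); apply: val_inj.
Qed.

Lemma mx2M (R : pzRingType) (a b c d a' b' c' d' : R) :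
  mx2 a b c d *m mx2 a' b' c' d' =
  mx2 (a * a' + b * c') (a * b' + b * d') (c * a' + d * c') (c * b' + d * d').
Proof.
by rewrite [LHS]mx2_eta !mxE !big_ord_recl !big_ord0 !mxE /= !addr0.
Qed.

Lemma mx2_1 (R : pzRingType) : mx2 1 0 0 1 = 1%:M :> 'M[R]_2.
Proof. by rewrite [RHS]mx2_eta !mxE. Qed.

(** A letter fixes five times its position. The positions 0 of x and -1 of y are chosen so that the
    matrix of the input pair has natural entries; all other letters get positive positions. *)
Definition letter_pos (l : letter) : int :=
  if l == Some (false, bX) then 0 else if l == Some (false, bY) then -1 else Posz (pickle l).+1.

Lemma letter_pos_inj : injective letter_pos.
Proof.
move=> a b; rewrite /letter_pos; do 4! case: eqP => [->|?] //; try lia.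
by move=> [/(pcan_inj pickleK)].
Qed.

(* The parabolic transformation v |-> q + (v - q) / (1 + z (v - q)) of the projective line. *)
Definition parabolic (q z : rat) : 'M[rat]_2 :=
  mx2 (1 + z * q) (- (z * q ^+ 2)) z (1 - z * q).

Lemma parabolicD q y z : parabolic q y *m parabolic q z = parabolic q (y + z).
Proof. by rewrite mx2M; congr mx2; ring. Qed.

Lemma parabolic0 q : parabolic q 0 = 1%:M.
Proof. by rewrite -mx2_1 /parabolic; congr mx2; ring. Qed.

Definition sign (s : bool) : rat := if s then 1 else -1.

Definition letter_mx (l : letter) (s : bool) : 'M[rat]_2 :=
  parabolic (5 * (letter_pos l)%:~R) (sign s).

Definition mx_sem (l : letter) (s : bool) (A : 'M[rat]_2) : 'M[rat]_2 := letter_mx l s *m A.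

Lemma mx_semK : is_action mx_sem.
Proof.
move=> l s A; rewrite /mx_sem /letter_mx mulmxA parabolicD.
by case: s => /=; rewrite ?subrr ?addNr parabolic0 mul1mx.
Qed.

Definition eval (w : word) : 'M[rat]_2 := act mx_sem w 1%:M.

Lemma act_mx_sem w A : act mx_sem w A = eval w *m A.
Proof.
elim: w => [|l w IH]; first by rewrite /eval mul1mx.
by rewrite /eval /= IH /mx_sem mulmxA.
Qed.

Lemma eval_cat v w : eval (v ++ w) = eval v *m eval w.
Proof. by rewrite {1}/eval act_cat act_mx_sem. Qed.

Lemma eval_winv w : eval (winv w) *m eval w = 1%:M.
Proof. by rewrite -eval_cat /eval act_cat (act_winvK mx_semK). Qed.

(* The ping-pong domain of l^s is the half of the interval of radius 2 about the fixed
   point of l into which l^s maps its complement. *)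
Definition in_domain (q e : rat) (v : rat * rat) : bool :=
  let w := v.1 - q * v.2 in (w != 0) && (w ^+ 2 <= 2 * e * w * v.2).

(** The map keeps z = v.1 - q v.2 and adds [sign s * z] to v.2. A point within 2 of q' lies at
    distance at least 5 - 2 = 3 from q, so 2 |z v.2| <= z^2, which puts the image in the domain. *)
Lemma parabolic_domain (q q' : rat) s s' (v : rat * rat) :
  in_domain q' (sign s') v -> (q = q' /\ s = s') \/ 5 <= `|q - q'| ->
  in_domain q (sign s) ((1 + sign s * q) * v.1 - sign s * q ^+ 2 * v.2,
                        sign s * v.1 + (1 - sign s * q) * v.2).
Proof.
case: v => a b; rewrite /in_domain /= => /andP[w0 hw].
set w := a - q' * b in w0 hw *; pose z := a - q * b.
have -> : (1 + sign s * q) * a - sign s * q ^+ 2 * b - q * (sign s * a + (1 - sign s * q) * b) = z.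
  by rewrite /z; ring.
have -> : sign s * a + (1 - sign s * q) * b = b + sign s * z by rewrite /z; ring.
case=> [[eq es]|far].
  have zw : z = w by rewrite /z eq.
  rewrite zw w0 /= -es in hw *; case: (s) hw => /=; nra.
have ew : w = z + (q - q') * b by rewrite /w /z; ring.
have w2 : 0 < w ^+ 2 by rewrite exprn_even_gt0.
have main : z != 0 /\ 3 * `|b| <= `|z|.
  have hb : `|w| <= 2 * `|b|.
    have w1 : 0 < `|w| by rewrite normr_gt0.
    have hwb : 2 * sign s' * w * b <= 2 * (`|w| * `|b|).
      rewrite -normrM; have := ler_norm (w * b); have := ler_norm (- (w * b)).
      by rewrite normrN; case: (s') => /=; lra.
    have nw : `|w| * `|w| = w ^+ 2 by rewrite -expr2 real_normK ?num_real.
    by rewrite -(ler_pM2l w1) nw; lra.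
  have b0 : 0 < `|b| by have : 0 < `|w| by [rewrite normr_gt0]; lra.
  have h3 : 3 * `|b| <= `|z|.
    have h5 : 5 * `|b| <= `|(q - q') * b| by rewrite normrM ler_wpM2r.
    have : `|(q - q') * b| <= `|w| + `|z|.
      by rewrite (_ : (q - q') * b = w - z); [exact: ler_normB | rewrite ew; ring].
    lra.
  split=> //; rewrite -normr_gt0; lra.
case: main => z0 hz; rewrite z0 /=.
have : 2 * `|z * b| <= z ^+ 2.
  have : 0 <= `|z| by []. rewrite -[z ^+ 2]ger0_norm ?sqr_ge0 // normrX normrM expr2.
  have : 0 <= `|b| by []. nra.
have := ler_norm (z * b); have := ler_norm (- (z * b)); rewrite normrN.
by case: (s) => /=; nra.
Qed.

Lemma eval_cons l w : eval (l :: w) = letter_mx l.1 l.2 *m eval w.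
Proof. by []. Qed.

(** The first column is the image of the point at infinity. The last letter of the word takes
    infinity into its own domain, and ping-pong handles each earlier letter. *)
Lemma reduced_domain l w : reduced (l :: w) ->
  in_domain (5 * (letter_pos l.1)%:~R) (sign l.2) (eval (l :: w) 0 0, eval (l :: w) 1 0).
Proof.
elim: w l => [|l' w IH] l.
  rewrite eval_cons /eval /= mulmx1 /letter_mx /parabolic !mxE /= /in_domain /= => _.
  set q := 5 * _; rewrite (_ : 1 + sign l.2 * q - q * sign l.2 = 1); last by ring.
  by case: l.2 => /=; lra.
case/andP=> ne /IH; rewrite (eval_cons l); move: (eval (l' :: w)) => A.
move/parabolic_domain => /(_ (5 * (letter_pos l.1)%:~R) l.2).
rewrite /letter_mx !mxE !big_ord_recl !big_ord0 !mxE /= !addr0.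
rewrite (_ : lift ord0 ord0 = 1); last exact: val_inj.
rewrite mulNr; apply; have [e|ne'] := eqVneq l.1 l'.1.
  left; rewrite e; split=> //; move: ne; rewrite (surjective_pairing l') xpair_eqE e eqxx /=.
  by case: l.2 l'.2 => -[].
right; rewrite -mulrBr -intrB normrM ger0_norm // -intr_norm ler_peMr // ler1z.
by rewrite -gtz0_ge1 normr_gt0 subr_eq0 (inj_eq letter_pos_inj).
Qed.

(** No ping-pong domain contains infinity: v.2 = 0 would give w^2 <= 0 with w nonzero. *)
Lemma eval_fixes_infinity w : eval w 1 0 = 0 -> reduce w = [::].
Proof.
rewrite /eval -(act_reduce mx_semK) -/(eval _); have := reduce_reduced w.
case: (reduce w) => // l v /reduced_domain; rewrite /in_domain /= => /andP[+ +] e.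
by rewrite e !mulr0 subr0 => h; rewrite le_eqVlt sqrf_eq0 (negbTE h) ltNge sqr_ge0.
Qed.

(** A single vanishing entry makes w^-1 v reduce to the empty word, so v and w agree under every
    action of the letters, not only on matrices. *)
Lemma act_eq_of_eval v w T (sem : letter -> bool -> T -> T) : is_action sem ->
  (invmx (eval w) *m eval v) 1 0 = 0 -> act sem v =1 act sem w.
Proof.
move=> semK; have -> : invmx (eval w) = eval (winv w).
  have /mulmx1_unit[_ u] := eval_winv w.
  by rewrite -[LHS]mul1mx -(eval_winv w) mulmxK.
rewrite -eval_cat => /eval_fixes_infinity e a.
rewrite -[LHS](act_winvVK semK w); congr act.
by rewrite -act_cat -(act_reduce semK) e.
Qed.

(** * A permutation model detecting non-halting *)

Definition decb (P : Prop) : bool := if excluded_middle_informative P then true else false.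

Lemma decbP (P : Prop) : reflect P (decb P).
Proof. by rewrite /decb; case: excluded_middle_informative; constructor. Qed.

(** A labelling of the configurations (i, z) and of a spare row [None]. A point carries a labelling,
    a counter, a position and a bit. A toggle flips the bit where the label is false; with labels
    recording acceptance, it fixes the origin iff the configuration accepts. *)
Definition label : Type := option nat -> int -> bool.
Definition point : Type := label * nat * int * bool.

Definition shift (z : int) (a : point) : point := let: (lab, n, u, e) := a in (lab, n, u + z, e).

Definition toggle (k : option nat) (z : int) (a : point) : point :=
  let: (lab, n, u, e) := a in (lab, n, u, e (+) ~~ lab k (u + z)).

Lemma shiftD y z a : shift y (shift z a) = shift (z + y) a.
Proof. by case: a => [[[lab n] u] e]; rewrite /= addrA. Qed.

Lemma shift0 a : shift 0 a = a.
Proof. by case: a => [[[lab n] u] e]; rewrite /= addr0. Qed.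

Lemma toggleK k z : involutive (toggle k z).
Proof. by case=> [[[lab n] u] e]; rewrite /= addbK. Qed.

Lemma toggle_shift k y z a : toggle k z (shift y a) = shift y (toggle k (y + z) a).
Proof. by case: a => [[[lab n] u] e]; rewrite /= addrA. Qed.

(* Exchanges the values of lab on the class a + (m + 1) Z of row i with those on the
   spare row [None]. *)
Definition swap_row (i : nat) (a : int) (m : nat) (lab : label) : label := fun k z =>
  match k with
  | None => lab (Some i) (a + m.+1%:Z * z)
  | Some j => if (j == i) && (m.+1 %| z - a)%Z then lab None ((z - a) %/ m.+1)%Z else lab (Some j) z
  end.

Lemma swap_rowK i a m : involutive (swap_row i a m).
Proof.
move=> lab; apply: functional_extensionality => k; apply: functional_extensionality => z.
case: k => [j|] /=; last first.
  by rewrite eqxx addrAC subrr add0r dvdz_mulr //= mulKz.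
case E: (_ && _) => //; case/andP: E => /eqP -> dv.
by rewrite mulrC divzK // addrC subrK.
Qed.

(* Turns the action of x^(m+1) and of the conjugate of t_i by x^c into that of x and of the
   toggle of the spare row, so that all such pairs are conjugate to one another. The residue of
   u is absorbed by the counter n. *)
Definition straighten (i m c : nat) (a : point) : point :=
  let: (lab, n, u, e) := a in
  (swap_row i (c%:Z + (u %% m.+1)%Z) m lab, (`|(u %% m.+1)%Z| + m.+1 * n)%N, (u %/ m.+1)%Z, e).

Definition unstraighten (i m c : nat) (a : point) : point :=
  let: (lab, n, u, e) := a in
  (swap_row i (c%:Z + (n %% m.+1)%N) m lab, (n %/ m.+1)%N, (n %% m.+1)%N%:Z + m.+1%:Z * u, e).

Lemma straightenK i m c : cancel (straighten i m c) (unstraighten i m c).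
Proof.
case=> [[[lab n] u] e] /=.
have q0 : 0 <= (u %% m.+1)%Z by rewrite modz_ge0.
have qm : (u %% m.+1)%Z < m.+1 by rewrite ltz_pmod.
have hq : (`|(u %% m.+1)%Z| < m.+1)%N by lia.
have e1 : ((`|(u %% m.+1)%Z| + m.+1 * n) %% m.+1 = `|(u %% m.+1)%Z|)%N.
  by rewrite mulnC addnC modnMDl modn_small.
rewrite e1 mulnC addnC divnMDl // divn_small // addn0 gez0_abs // swap_rowK.
by rewrite mulrC addrC -divz_eq.
Qed.

Lemma unstraightenK i m c : cancel (unstraighten i m c) (straighten i m c).
Proof.
case=> [[[lab n] u] e] /=.
have lt : (n %% m.+1 < m.+1)%N by rewrite ltn_mod.
have e1 : (((n %% m.+1)%N%:Z + m.+1%:Z * u) %% m.+1)%Z = (n %% m.+1)%N.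
  by rewrite addrC mulrC modzMDl modz_small //=; lia.
have e2 : (((n %% m.+1)%N%:Z + m.+1%:Z * u) %/ m.+1)%Z = u.
  by rewrite addrC mulrC divzMDl // divz_small ?addr0 //=; lia.
by rewrite e1 e2 /= swap_rowK; congr (_, _, _, _); rewrite addnC mulnC -divn_eq.
Qed.

Lemma straighten_shift i m c a :
  straighten i m c (shift m.+1 a) = shift 1 (straighten i m c a).
Proof.
case: a => [[[lab n] u] e] /=.
have e1 : ((u + m.+1%:Z) %% m.+1)%Z = (u %% m.+1)%Z by rewrite modzDr.
have e2 : ((u + m.+1%:Z) %/ m.+1)%Z = (u %/ m.+1)%Z + 1.
  by rewrite addrC -[X in X + u]mul1r divzMDl // addrC.
by rewrite e1 e2.
Qed.

Lemma straighten_toggle i m c a :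
  straighten i m c (toggle (Some i) c a) = toggle None 0 (straighten i m c a).
Proof.
case: a => [[[lab n] u] e] /=; congr (_, _, _, _ (+) ~~ lab _ _).
by rewrite addr0 [in LHS](divz_eq u m.+1) [in LHS]addrC mulrC -addrA; congr (_ + _); rewrite addrC.
Qed.

Lemma unstraighten_shift i m c a :
  unstraighten i m c (shift 1 a) = shift m.+1 (unstraighten i m c a).
Proof. by rewrite -{1}(unstraightenK i m c a) -straighten_shift straightenK. Qed.

Lemma unstraighten_toggle i m c a :
  unstraighten i m c (toggle None 0 a) = toggle (Some i) c (unstraighten i m c a).
Proof. by rewrite -{1}(unstraightenK i m c a) -straighten_toggle straightenK. Qed.

(** A transposition of two labellings, used to match the two straightened images of the origin.
    Equality of labellings is decided classically. *)
Definition relabel (A B : label) (a : point) : point :=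
  let: (lab, n, u, e) := a in
  ((if decb (lab = A) then B else if decb (lab = B) then A else lab), n, u, e).

Lemma relabelK A B : involutive (relabel A B).
Proof.
case=> [[[lab n] u] e] /=; congr (_, _, _, _).
case: (decbP (lab = A)) => [->|nA]; last case: (decbP (lab = B)) => [->|nB];
  by repeat (case: decbP => /= ?); congruence.
Qed.

Lemma relabel_shift A B z a : relabel A B (shift z a) = shift z (relabel A B a).
Proof. by case: a => [[[lab n] u] e]. Qed.

Lemma relabel_toggle A B a : A None =1 B None ->
  relabel A B (toggle None 0 a) = toggle None 0 (relabel A B a).
Proof.
move=> AB; case: a => [[[lab n] u] e] /=; congr (_, _, _, _ (+) ~~ _).
by case: decbP => [->|_] //; case: decbP => [->|_].
Qed.

Arguments shift : simpl never.
Arguments toggle : simpl never.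

Section PermutationModel.

Variables (p : seq instr) (N : nat).

Definition accept_label : label := fun k z => if k is Some i then decb (accepts p i z) else false.

Definition origin : point := (accept_label, 0%N, 0, false).

(** Both straightenings lead to the standard pair of [shift 1] and [toggle None 0]. The relabelling
    in between makes the composite fix the origin, and commutes with that toggle because a rule
    preserves acceptance. *)
Definition rule_fun (rho : rule) : point -> point :=
  let: ((i, m, c), (j, n, d)) := rho in
  unstraighten j n d \o
  relabel (swap_row i c m accept_label) (swap_row j d n accept_label) \o straighten i m c.

Definition rule_inv (rho : rule) : point -> point :=
  let: ((i, m, c), (j, n, d)) := rho in
  unstraighten i m c \o
  relabel (swap_row i c m accept_label) (swap_row j d n accept_label) \o straighten j n d.

Lemma rule_funK rho : cancel (rule_fun rho) (rule_inv rho).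
Proof.
by case: rho => [[[i m] c] [[j n] d]] a; rewrite /= unstraightenK relabelK straightenK.
Qed.

Lemma rule_invK rho : cancel (rule_inv rho) (rule_fun rho).
Proof.
by case: rho => [[[i m] c] [[j n] d]] a; rewrite /= unstraightenK relabelK straightenK.
Qed.

Lemma rule_fun_origin rho : rule_fun rho origin = origin.
Proof.
case: rho => [[[i m] c] [[j n] d]]; rewrite /= mod0z div0z addr0 muln0 !addn0 mod0n div0n addr0.
by case: decbP => // _; rewrite swap_rowK mulr0 addr0.
Qed.

Lemma rule_fun_shift i m c j n d a : let rho := ((i, m, c), (j, n, d)) in
  rule_fun rho (shift m.+1 a) = shift n.+1 (rule_fun rho a).
Proof. by rewrite /= straighten_shift relabel_shift unstraighten_shift. Qed.

Lemma rule_fun_toggle i m c j n d a : let rho := ((i, m, c), (j, n, d)) in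
  rho \in rules p ->
  rule_fun rho (toggle (Some i) c a) = toggle (Some j) d (rule_fun rho a).
Proof.
move=> rho mem; rewrite /= straighten_toggle relabel_toggle ?unstraighten_toggle // => u /=.
by apply/decbP/decbP => /(rules_accepts u mem).
Qed.

Definition sign_int (s : bool) : int := if s then 1 else -1.

Definition base_sem (b : base) (s : bool) : point -> point :=
  match b with
  | None => shift (sign_int s)
  | Some None => shift (sign_int s * N.+1%:Z)
  | Some (Some (inl i)) => toggle (Some i) 0
  | Some (Some (inr rho)) => if s then rule_fun rho else rule_inv rho
  end.

Lemma base_semK b s : cancel (base_sem b s) (base_sem b (~~ s)).
Proof.
case: b => [[[i|rho]|]|] a /=.
- exact: toggleK.
- by case: s; rewrite /= ?rule_funK ?rule_invK.
- by rewrite shiftD -mulrDl; case: s; rewrite /= ?subrr ?addNr mul0r shift0.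
- by rewrite shiftD; case: s; rewrite /= ?subrr ?addNr shift0.
Qed.

Definition lift_point (g : point -> point) (a : point * int) : point * int := (g a.1, a.2).

Definition fibre_shift (o : point) (z : int) (a : point * int) : point * int :=
  if decb (a.1 = o) then (a.1, a.2 + z) else a.

Lemma fibre_shiftD o y z a : fibre_shift o y (fibre_shift o z a) = fibre_shift o (z + y) a.
Proof.
by rewrite /fibre_shift; case E: (decb (a.1 = o)); rewrite /= E // addrA.
Qed.

Lemma fibre_shift0 o a : fibre_shift o 0 a = a.
Proof. by rewrite /fibre_shift addr0; case: a => ? ? /=; case: decbP. Qed.

Lemma fibre_shift_lift o z g a : injective g ->
  fibre_shift (g o) z (lift_point g a) = lift_point g (fibre_shift o z a).
Proof.
move=> g_inj; rewrite /fibre_shift /lift_point /=.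
by case: decbP => [/g_inj|] e; case: decbP => // e'; case: e; rewrite e'.
Qed.

(* f acts as the shift along the fibre over o, the letters b with b = primed act through their
   base letter and the other ones act trivially. *)
Definition side_sem (primed : bool) (o : point) (l : letter) (s : bool) :
    point * int -> point * int :=
  match l with
  | None => fibre_shift o (sign_int s)
  | Some (b, a) => if b == primed then lift_point (base_sem a s) else id
  end.

Lemma side_semK primed o : is_action (side_sem primed o).
Proof.
case=> [[b a]|] s w /=; last first.
  by rewrite fibre_shiftD; case: s; rewrite /= ?subrr ?addNr fibre_shift0.
by case: ifP => // _; rewrite /lift_point /= base_semK; case: w.
Qed.

End PermutationModel.

Arguments rule_fun : simpl never.

(** * The generating pairs of words *)

Definition fst_word (a : base) : word := [:: (Some (false, a), true)].
Definition snd_word (a : base) : word := [:: (Some (true, a), true)].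
Definition f_word : word := [:: (None, true)].
Definition x_power (n : nat) : word := nseq n (Some (false, bX), true).
Definition conj_word (v w : word) : word := winv w ++ v ++ w.
Definition relator (u v w : word) : word := (u ++ v ++ winv u) ++ winv w.

Definition rule_relator_x (rho : rule) : word :=
  let: ((i, m, c), (j, n, d)) := rho in
  relator (fst_word (bR rho)) (x_power m.+1) (x_power n.+1).

Definition rule_relator_t (rho : rule) : word :=
  let: ((i, m, c), (j, n, d)) := rho in
  relator (fst_word (bR rho)) (conj_word (fst_word (bT i)) (x_power c))
    (conj_word (fst_word (bT j)) (x_power d)).

Definition f_relator (w : word) : word := relator f_word w w.

(** None of these pairs depends on the input: y x^-1 stands for x^N, and the value of N enters only
    through [input_pair]. *)
Definition machine_pairs (p : seq instr) : seq (word * word) :=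
  [seq (fst_word a, snd_word a) |
     a <- [:: bX; bY] ++ [seq bT i | i <- iota 0 (size p).+1] ++ [seq bR rho | rho <- rules p]] ++
  [seq (rule_relator_x rho, [::]) | rho <- rules p] ++
  [seq (rule_relator_t rho, [::]) | rho <- rules p] ++
  [seq (f_relator (fst_word a), [::]) | a <- bT (size p) :: [seq bR rho | rho <- rules p]] ++
  [:: (f_word, conj_word f_word
         (winv (conj_word (snd_word (bT 0)) (snd_word bY ++ winv (snd_word bX)))))].

(** With the exponent N + 1 in place of N, the matrix has entries affine in N with natural
    coefficients, even after subtracting the identity. *)
Definition input_pair (N : nat) : word * word := (x_power N.+1 ++ winv (fst_word bY), [::]).

Inductive generated (P : seq (word * word)) : word -> word -> Prop :=
  | generated_base v w : (v, w) \in P -> generated P v w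
  | generated_one : generated P [::] [::]
  | generated_cat v w v' w' :
      generated P v w -> generated P v' w' -> generated P (v ++ v') (w ++ w')
  | generated_winv v w : generated P v w -> generated P (winv v) (winv w).

Section ActRelations.

Variables (T : Type) (sem : letter -> bool -> T -> T).
Hypothesis semK : is_action sem.

Lemma act_relator u v w : (forall b, act sem u (act sem v b) = act sem w (act sem u b)) ->
  act sem (relator u v w) =1 id.
Proof.
move=> h a; rewrite /relator !act_cat h.
by rewrite !(act_winvVK semK).
Qed.

Lemma act_conj_word v w g : (forall b, act sem v (act sem w b) = act sem w (g b)) ->
  act sem (conj_word v w) =1 g.
Proof. by move=> h a; rewrite /conj_word !act_cat h (act_winvK semK). Qed.

End ActRelations.

(** * Soundness: diagonal pairs are trivial when the machine does not halt *)

Definition exponent (w : word) : int :=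
  foldr (fun l z => (if l.1 is None then sign_int l.2 else 0) + z) 0 w.

Definition on_side (primed : bool) (w : word) : bool :=
  all (fun l : letter * bool => if l.1 is Some (b, _) then b == primed else true) w.

Lemma on_side_winv primed w : on_side primed (winv w) = on_side primed w.
Proof. by rewrite /on_side /winv all_rev all_map. Qed.

Lemma on_side_cat primed v w : on_side primed (v ++ w) = on_side primed v && on_side primed w.
Proof. exact: all_cat. Qed.

Lemma act_exponent T (sem : letter -> bool -> T -> T) (phi : int -> T -> T) primed w :
  phi 0 =1 id -> (forall y z a, phi y (phi z a) = phi (y + z) a) ->
  (forall s, sem None s =1 phi (sign_int s)) ->
  (forall a s, sem (Some (~~ primed, a)) s =1 id) ->
  on_side (~~ primed) w -> act sem w =1 phi (exponent w).
Proof.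
move=> phi0 phiD semf sem1; elim: w => [_ a|[l s] w IH] /=; first by rewrite phi0.
case: l => [[b a]|] /= => [/andP[/eqP -> /IH h]|/IH h] c.
  by rewrite /= sem1 h add0r.
by rewrite /= semf h phiD.
Qed.

(** The matrix action of the free group after the letters of the other side are sent to 1. *)
Definition side_mx (primed : bool) (l : letter) (s : bool) : 'M[rat]_2 -> 'M[rat]_2 :=
  if l is Some (b, _) then if b == primed then mx_sem l s else id else mx_sem l s.

Lemma side_mxK primed : is_action (side_mx primed).
Proof. by case=> [[b a]|] s c /=; [case: ifP => // _|]; rewrite mx_semK. Qed.

Lemma act_side_mx primed w : on_side primed w -> act (side_mx primed) w =1 act mx_sem w.
Proof.
move=> h a; elim: w h => //= -[l s] w IH.
case: l => [[b c]|] /= => [/andP[/eqP-> /IH ->]|/IH ->] //.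
by rewrite eqxx.
Qed.

Lemma act_side_mx_other primed w : on_side (~~ primed) w -> exponent w = 0 ->
  act (side_mx primed) w =1 id.
Proof.
move=> h e A; set q := 5 * (letter_pos None)%:~R : rat.
rewrite (@act_exponent _ _ (fun z B => parabolic q z%:~R *m B) primed _ _ _ _ _ h).
- by rewrite e parabolic0 mul1mx.
- by move=> B; rewrite parabolic0 mul1mx.
- by move=> y z B; rewrite mulmxA parabolicD intrD.
- by move=> s B; rewrite /= /mx_sem /letter_mx; case: s.
- by move=> a s B /=; case: primed {h}.
Qed.

Section Soundness.

Variables (p : seq instr) (N : nat).

Let orig := origin p.
(** The image of the origin under the toggle of the initial configuration (0, N). The two sides let
    f shift the fibres over [orig] and [orig2], which differ when (0, N) does not accept. *)
Let orig2 := toggle (Some 0%N) N orig.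
Let sem1 := side_sem p N false orig.
Let sem2 := side_sem p N true orig2.

Let sem1K : is_action sem1. Proof. exact: side_semK. Qed.
Let sem2K : is_action sem2. Proof. exact: side_semK. Qed.

Lemma act_x_power n a : act sem1 (x_power n) a = lift_point (shift n) a.
Proof.
elim: n => [|n IH]; first by case: a => a k; rewrite /lift_point shift0.
rewrite /x_power /= -/(x_power n) IH /lift_point /= shiftD.
by rewrite -addn1 PoszD.
Qed.

Lemma act_conj_toggle i c a :
  act sem1 (conj_word (fst_word (bT i)) (x_power c)) a = lift_point (toggle (Some i) c) a.
Proof.
apply: (act_conj_word sem1K) => {a} a.
by rewrite !act_x_power /= /lift_point /= toggle_shift addr0.
Qed.

(** The letter f moves only the fibre over the origin, so it commutes with every lifted permutation
    fixing the origin. *)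
Lemma act_f_relator a : base_sem p N a true orig = orig ->
  act sem1 (f_relator (fst_word a)) =1 id.
Proof.
move=> fix_o; apply: (act_relator sem1K) => b /=.
by rewrite -[in LHS]fix_o fibre_shift_lift //; apply: can_inj (base_semK p N a true).
Qed.

Lemma act_rule_relator_x rho : act sem1 (rule_relator_x rho) =1 id.
Proof.
case: rho => [[[i m] c] [[j n] d]]; apply: (act_relator sem1K) => b.
by rewrite !act_x_power /= /lift_point [in LHS]rule_fun_shift.
Qed.

Lemma act_rule_relator_t rho : rho \in rules p -> act sem1 (rule_relator_t rho) =1 id.
Proof.
case: rho => [[[i m] c] [[j n] d]] mem; apply: (act_relator sem1K) => b.
by rewrite !act_conj_toggle /= /lift_point [in LHS](rule_fun_toggle _ mem).
Qed.

Lemma act_input_pair : act sem1 (input_pair N).1 =1 id.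
Proof.
move=> a; rewrite act_cat act_x_power /= /lift_point /= shiftD.
by rewrite -{2}(mul1r N.+1%:Z) -mulrDl addNr mul0r shift0; case: a.
Qed.

(** Conjugation by the toggle of (0, N) carries the fibre over [orig2] back to the fibre over
    [orig]. *)
Lemma act_last_pair a :
  act sem2 (conj_word f_word
    (winv (conj_word (snd_word (bT 0)) (snd_word bY ++ winv (snd_word bX))))) a = act sem1 f_word a.
Proof.
move: a; apply: (act_conj_word sem2K) => a.
set w := conj_word (snd_word _) _.
have e b : act sem2 w b = lift_point (toggle (Some 0%N) N) b.
  apply: (act_conj_word sem2K) => {b} b; rewrite /= /lift_point /= !shiftD toggle_shift.
by congr (shift _ (toggle _ _ _), _); lia.
have e' b : act sem2 (winv w) b = lift_point (toggle (Some 0%N) N) b.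
  rewrite -[RHS](act_winvK sem2K w) e; congr (act _ _ _).
  by rewrite /lift_point toggleK; case: b.
rewrite !e' /= -/orig -fibre_shift_lift; last exact: inv_inj (toggleK _ _).
by congr fibre_shift.
Qed.

Lemma generated_act v w :
  generated (input_pair N :: machine_pairs p) v w -> act sem1 v =1 act sem2 w.
Proof.
elim=> {v w} [v w|//|v w v' w' _ IH _ IH' a|v w _ IH a]; last 2 first.
- by rewrite !act_cat IH IH'.
- by rewrite -[RHS](act_winvK sem1K v) IH (act_winvVK sem2K).
rewrite inE => /orP[/eqP e|]; first by case: e (act_input_pair) => -> ->.
rewrite /machine_pairs !mem_cat => /or4P[/mapP[a _ [-> ->]]|/mapP[rho _ [-> ->]]|
  /mapP[rho mem [-> ->]]|/orP[/mapP[a mem [-> ->]]|]].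
- by [].
- exact: act_rule_relator_x.
- exact: act_rule_relator_t.
- apply: act_f_relator; move: mem; rewrite inE => /orP[/eqP ->|/mapP[rho _ ->]].
    rewrite /orig /= /origin /toggle /=.
    by case: decbP => // h; case: h; exact: accepts_halted.
  exact: rule_fun_origin.
- by rewrite inE => /eqP[-> ->] a; rewrite act_last_pair.
Qed.

Lemma generated_on_side v w :
  generated (input_pair N :: machine_pairs p) v w -> on_side false v && on_side true w.
Proof.
have x_side n : on_side false (x_power n) by rewrite /on_side all_nseq orbT.
elim=> {v w} [v w|//|v w v' w' _ /andP[h1 h2] _ /andP[h3 h4]|v w _]; last 2 first.
- by rewrite !on_side_cat h1 h2 h3 h4.
- by rewrite !on_side_winv.
rewrite inE => /orP[/eqP e|].
  have [-> ->] : v = (input_pair N).1 /\ w = [::] by rewrite -e; case: e.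
  by rewrite on_side_cat x_side.
rewrite /machine_pairs !mem_cat => /or4P[/mapP[a _ [-> ->]]|/mapP[rho _ [-> ->]]|
  /mapP[rho mem [-> ->]]|/orP[/mapP[a mem [-> ->]]|]] //.
- case: rho => [[[i m] c] [[j n] d]].
  by rewrite /rule_relator_x /relator !(on_side_cat, on_side_winv) !x_side.
- case: rho {mem} => [[[i m] c] [[j n] d]].
  by rewrite /rule_relator_t /relator /conj_word !(on_side_cat, on_side_winv) !x_side.
- by rewrite inE => /eqP[-> ->].
Qed.

(** A zero corner makes v and w equal in the free group. Under [sem1] only the letters f of w act,
    under [sem2] only those of v, so a shift of the fibre over [orig] equals one over [orig2]. These
    fibres are disjoint, so both f-exponents vanish. *)
Lemma soundness v w : ~ accepts p 0 N ->
  generated (input_pair N :: machine_pairs p) v w ->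
  (invmx (eval w) *m eval v) 1 0 = 0 -> eval v = 1%:M /\ eval w = 1%:M.
Proof.
move=> nacc gen e; have /andP[hv hw] := generated_on_side gen.
have eq T (sem : letter -> bool -> T -> T) (semK : is_action sem) := act_eq_of_eval semK e.
have act1 : act sem1 w =1 fibre_shift orig (exponent w).
  apply: (act_exponent (primed := false)) hw => //; [exact: fibre_shift0 |].
  by move=> y z a; rewrite fibre_shiftD addrC.
have act2 : act sem2 v =1 fibre_shift orig2 (exponent v).
  apply: (act_exponent (primed := true)) hv => //; [exact: fibre_shift0 |].
  by move=> y z a; rewrite fibre_shiftD addrC.
have E a : fibre_shift orig (exponent w) a = fibre_shift orig2 (exponent v) a.
  by rewrite -act1 -act2 -(eq _ _ sem1K) (generated_act gen) (eq _ _ sem2K).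
(* As (0, N) does not accept, the toggle flips the bit of the origin. *)
have ne : orig2 <> orig.
  rewrite /orig2 /orig /origin /toggle => -[] /eqP; rewrite /= add0r.
  by case: decbP.
have ew : exponent w = 0.
  have := E (orig, 0); rewrite /fibre_shift /=; case: decbP => // _.
  case: decbP => [e'|_ []]; [by case: ne | by rewrite add0r].
have ev : exponent v = 0.
  have := E (orig2, 0); rewrite /fibre_shift /=; case: decbP => [/ne//|_].
  by case: decbP => // _ []; rewrite add0r.
(* Killing the primed letters leaves v unchanged and makes w, whose f-exponent is 0, trivial; the
   second claim is symmetric. *)
split; rewrite /eval.
  rewrite -(act_side_mx hv) (eq _ _ (@side_mxK false)).
  exact: (act_side_mx_other (primed := false)).
rewrite -(act_side_mx hw) -(eq _ _ (@side_mxK true)).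
exact: (act_side_mx_other (primed := true)).
Qed.

End Soundness.

(** * The matrix representation *)

Definition unit_mx2 : Type := {A : 'M[rat]_2 | A \in unitmx}.
HB.instance Definition _ := Choice.on unit_mx2.

Definition unit_mx2_val (A : unit_mx2) : 'M[rat]_2 := sval A.

Lemma unit_mx2_inj : injective unit_mx2_val.
Proof. exact: val_inj. Qed.

Lemma unit_mx2P (A : unit_mx2) : unit_mx2_val A \in unitmx.
Proof. exact: valP. Qed.

Lemma unit_mx2_mul_subproof (A B : unit_mx2) : unit_mx2_val A *m unit_mx2_val B \in unitmx.
Proof. by rewrite unitmx_mul !unit_mx2P. Qed.

Lemma unit_mx2_inv_subproof (A : unit_mx2) : invmx (unit_mx2_val A) \in unitmx.
Proof. by rewrite unitmx_inv unit_mx2P. Qed.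

Definition unit_mx2_one : unit_mx2 := exist (fun C : 'M[rat]_2 => C \in unitmx) 1%:M (unitmx1 _ _).
Definition unit_mx2_mul (A B : unit_mx2) : unit_mx2 :=
  exist (fun C : 'M[rat]_2 => C \in unitmx) _ (unit_mx2_mul_subproof A B).
Definition unit_mx2_inv (A : unit_mx2) : unit_mx2 :=
  exist (fun C : 'M[rat]_2 => C \in unitmx) _ (unit_mx2_inv_subproof A).

Lemma unit_mx2_mulA : associative unit_mx2_mul.
Proof. by move=> A B C; apply: unit_mx2_inj; exact: mulmxA. Qed.

Lemma unit_mx2_mul1 : left_id unit_mx2_one unit_mx2_mul.
Proof. by move=> A; apply: unit_mx2_inj; exact: mul1mx. Qed.

Lemma unit_mx2_1mul : right_id unit_mx2_one unit_mx2_mul.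
Proof. by move=> A; apply: unit_mx2_inj; exact: mulmx1. Qed.

Lemma unit_mx2_mulV : left_inverse unit_mx2_one unit_mx2_inv unit_mx2_mul.
Proof. by move=> A; apply: unit_mx2_inj; exact: mulVmx (unit_mx2P A). Qed.

Lemma unit_mx2_Vmul : right_inverse unit_mx2_one unit_mx2_inv unit_mx2_mul.
Proof. by move=> A; apply: unit_mx2_inj; exact: mulmxV (unit_mx2P A). Qed.

HB.instance Definition _ := isGroup.Build unit_mx2 unit_mx2_mulA unit_mx2_mul1
  unit_mx2_1mul unit_mx2_mulV unit_mx2_Vmul.

Lemma eval_unit w : eval w \in unitmx.
Proof. by have /mulmx1_unit[] := eval_winv w. Qed.

Lemma eval_winvE w : eval (winv w) = invmx (eval w).
Proof. by rewrite -[LHS]mulmx1 -(mulmxV (eval_unit w)) mulmxA eval_winv mul1mx. Qed.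

Definition geval (w : word) : unit_mx2 :=
  exist (fun C : 'M[rat]_2 => C \in unitmx) (eval w) (eval_unit w).

Lemma geval_cat v w : geval (v ++ w) = (geval v * geval w)%g.
Proof. by apply: unit_mx2_inj; exact: eval_cat. Qed.

Lemma geval_nil : geval [::] = 1%g.
Proof. exact: unit_mx2_inj. Qed.

Lemma geval_winv w : geval (winv w) = (geval w)^-1%g.
Proof. by apply: unit_mx2_inj; exact: eval_winvE. Qed.

Lemma geval_x_power n : geval (x_power n) = (geval (fst_word bX) ^+ n)%g.
Proof.
elim: n => [|n IH]; first by rewrite expg0 geval_nil.
by rewrite expgS -IH -geval_cat.
Qed.

Lemma geval_relator u v w :
  geval (relator u v w) = (geval u * geval v * (geval u)^-1 * (geval w)^-1)%g.
Proof. by rewrite /relator !geval_cat !geval_winv !mulgA. Qed.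

Lemma geval_conj_word v w : geval (conj_word v w) = (geval v ^ geval w)%g.
Proof. by rewrite /conj_word !geval_cat geval_winv. Qed.

Lemma geval_rule_relator_x i m c j n d :
  let r := geval (fst_word (bR ((i, m, c), (j, n, d)))) in
  let x := geval (fst_word bX) in
  geval (rule_relator_x ((i, m, c), (j, n, d))) = (r * x ^+ m.+1 * r^-1 * x ^- n.+1)%g.
Proof. by move=> r x; rewrite [LHS]geval_relator !geval_x_power. Qed.

Lemma geval_rule_relator_t i m c j n d :
  let r := geval (fst_word (bR ((i, m, c), (j, n, d)))) in
  let x := geval (fst_word bX) in
  geval (rule_relator_t ((i, m, c), (j, n, d))) =
    (r * geval (fst_word (bT i)) ^ (x ^+ c) * r^-1 * (geval (fst_word (bT j)) ^ (x ^+ d))^-1)%g.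
Proof. by move=> r x; rewrite [LHS]geval_relator !geval_conj_word !geval_x_power. Qed.

Section Representation.

Variable n : nat.
Hypothesis n_gt5 : (5 < n.+1)%N.

(** Coordinates 1 to 4 hold a 2 x 2 matrix. Row 0 here holds the vectorised identity, and the last
    column of [project_mx] selects the (1,0)-entry; together they make the corner of [rep a b] the
    (1,0)-entry of b^-1 a. *)
Definition embed_mx : 'M[rat]_(n.+1, 2 * 2) :=
  \matrix_(i, k) if i == 0 :> nat then mxvec 1%:M 0 k else (i == k.+1 :> nat)%:R.

Definition project_mx : 'M[rat]_(2 * 2, n.+1) :=
  \matrix_(k, j) (if j == n :> nat then k == mxvec_index 1 0 else j == k.+1 :> nat)%:R.

Lemma project_embed : project_mx *m embed_mx = 1%:M.
Proof.
apply/matrixP => k l; rewrite !mxE.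
have hk := ltn_ord k; have hl := ltn_ord l; rewrite -[X in (_ < X)%N]/4%N in hk hl.
have lk : (k.+1 < n.+1)%N by lia.
rewrite (bigD1 (Ordinal lk)) //= !mxE /= ifF; last by apply/eqP; lia.
rewrite eqxx mul1r eqSS big1 ?addr0 // => j jk; rewrite !mxE.
have jk' : (j == k.+1 :> nat) = false by rewrite -(inj_eq val_inj) /= in jk; exact: negbTE.
case: eqP => [jn|_]; last by rewrite jk' mul0r.
rewrite (_ : (j == 0 :> nat) = false) 1?(_ : (j == l.+1 :> nat) = false) ?mulr0 //; lia.
Qed.

(* The operator X |-> b^-1 X a on 2 x 2 matrices, acting on row vectors. *)
Definition two_sided (a b : 'M[rat]_2) : 'M[rat]_(2 * 2) := lin_mulmx (invmx b) *m lin_mulmxr a.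

Lemma mul_two_sided X a b : mxvec X *m two_sided a b = mxvec (invmx b *m X *m a).
Proof. by rewrite /two_sided mulmxA !mul_vec_lin. Qed.

Lemma eq_on_mxvec (A B : 'M[rat]_(2 * 2)) :
  (forall X : 'M_2, mxvec X *m A = mxvec X *m B) -> A = B.
Proof. by move=> h; apply/row_matrixP => i; rewrite !rowE -[delta_mx 0 i]vec_mxK h. Qed.

Lemma two_sidedM a b a' b' : b \in unitmx -> b' \in unitmx ->
  two_sided (a *m a') (b *m b') = two_sided a b *m two_sided a' b'.
Proof.
move=> ub ub'; apply: eq_on_mxvec => X; rewrite mulmxA !mul_two_sided.
rewrite (_ : invmx (b *m b') = invmx b' *m invmx b) ?mulmxA //.
by rewrite -[LHS]/((b * b')^-1) invrM.
Qed.

Lemma two_sided1 : two_sided 1%:M 1%:M = 1%:M.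
Proof. by apply: eq_on_mxvec => X; rewrite mul_two_sided invmx1 mul1mx !mulmx1. Qed.

(** Since [project_mx *m embed_mx] is the identity, T |-> 1 + E (T - 1) P is multiplicative in T. *)
Definition rep (a b : 'M[rat]_2) : 'M[rat]_n.+1 :=
  1%:M + embed_mx *m (two_sided a b - 1%:M) *m project_mx.

Lemma repM a b a' b' : b \in unitmx -> b' \in unitmx ->
  rep (a *m a') (b *m b') = rep a b *m rep a' b'.
Proof.
move=> ub ub'; rewrite /rep two_sidedM //.
move: (two_sided a b) (two_sided a' b') => u u'.
have -> : u *m u' - 1%:M = (u - 1%:M) + (u' - 1%:M) + (u - 1%:M) *m (u' - 1%:M).
  rewrite -{1}(subrK 1%:M u) -{1}(subrK 1%:M u').
  move: (u - 1%:M) (u' - 1%:M) => v v'.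
  by rewrite mulmxDl mul1mx mulmxDr mulmx1 addrA addrK -addrA addrC.
move: (u - 1%:M) (u' - 1%:M) => v v'.
have -> : embed_mx *m (v + v' + v *m v') *m project_mx =
  embed_mx *m v *m project_mx + embed_mx *m v' *m project_mx +
  embed_mx *m v *m project_mx *m (embed_mx *m v' *m project_mx).
  rewrite !mulmxDr !mulmxDl; congr (_ + _).
  by rewrite !mulmxA -(mulmxA _ project_mx) project_embed mulmx1.
move: (embed_mx *m v *m _) (embed_mx *m v' *m _) => w w'.
by rewrite mulmxDl mul1mx mulmxDr mulmx1 -!addrA; congr (_ + _); rewrite addrCA.
Qed.

Lemma rep1 : rep 1%:M 1%:M = 1%:M.
Proof. by rewrite /rep two_sided1 subrr mulmx0 mul0mx addr0. Qed.

Lemma rep_unit a b : a \in unitmx -> b \in unitmx ->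
  rep a b \in unitmx /\ invmx (rep a b) = rep (invmx a) (invmx b).
Proof.
move=> ua ub; have e : rep a b *m rep (invmx a) (invmx b) = 1%:M.
  by rewrite -repM ?unitmx_inv // !mulmxV // rep1.
have [u _] := mulmx1_unit e; split=> //.
by rewrite -[LHS]mulmx1 -e mulmxA mulVmx // mul1mx.
Qed.

Lemma rep_corner a b : upper_right (rep a b) = (invmx b *m a) 1 0.
Proof.
rewrite /= /rep mxE [_%:M _ _]mxE (_ : ord0 == ord_max = false) ?add0r; last first.
  by apply/eqP => /(congr1 val) /=; lia.
have -> : (embed_mx *m (two_sided a b - 1%:M) *m project_mx) ord0 ord_max =
   (mxvec 1%:M *m (two_sided a b - 1%:M)) 0 (mxvec_index 1 0).
  rewrite mxE (bigD1 (mxvec_index 1 0)) //= big1 => [|k /negbTE hk]; last first.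
    by rewrite [project_mx _ _]mxE eqxx hk mulr0.
  rewrite [project_mx _ _]mxE !eqxx mulr1 addr0 !mxE.
  by apply: eq_bigr => k _; rewrite [embed_mx _ _]mxE.
by rewrite mulmxBr mulmx1 mul_two_sided mulmx1 mxE [X in _ + X]mxE !mxvecE [_%:M _ _]mxE subr0.
Qed.

Lemma rep_neq1 a b X : invmx b *m X *m a != X -> rep a b != 1%:M.
Proof.
apply: contra_neq => e.
have {}e : embed_mx *m (two_sided a b - 1%:M) *m project_mx = 0.
  by apply: (addrI 1%:M); rewrite addr0.
have e2 : two_sided a b - 1%:M = 0.
  have := congr1 (fun Z => project_mx *m Z *m embed_mx) e.
  by rewrite mulmx0 mul0mx !mulmxA project_embed mul1mx -mulmxA project_embed mulmx1.
apply: (can_inj mxvecK); rewrite -mul_two_sided.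
by rewrite (_ : two_sided a b = 1%:M) ?mulmx1 //; apply/eqP; rewrite -subr_eq0 e2.
Qed.

Lemma nat_affine_add g h : nat_affine g -> nat_affine h -> nat_affine (fun k => g k + h k).
Proof.
move=> [c [d hg]] [c' [d' hh]]; exists (c + c')%N, (d + d')%N => k.
by rewrite hg hh -natrD mulnDl addnACA.
Qed.

Lemma nat_affine_const (c : nat) : nat_affine (fun=> c%:R).
Proof. by exists c, 0%N => k; rewrite mul0n addn0. Qed.

Lemma nat_affine_mul (c : nat) g : nat_affine g -> nat_affine (fun k => c%:R * g k).
Proof.
move=> [c' [d' hg]]; exists (c * c')%N, (c * d')%N => k.
by rewrite hg -natrM mulnDr mulnA.
Qed.

Lemma nat_affine_sum (I : Type) (s : seq I) (g : I -> nat -> rat) :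
  (forall i, nat_affine (g i)) -> nat_affine (fun k => \sum_(i <- s) g i k).
Proof.
move=> hg; elim: s => [|i s IH].
  by have [c [d h]] := nat_affine_const 0; exists c, d => k; rewrite big_nil -h.
by have [c [d h]] := nat_affine_add (hg i) IH; exists c, d => k; rewrite big_cons -h.
Qed.

Lemma eq_nat_affine g h : g =1 h -> nat_affine g -> nat_affine h.
Proof. by move=> e [c [d hg]]; exists c, d => k; rewrite -e. Qed.

(** For b = 1 the operator minus the identity is right multiplication by a - 1, whose matrix has
    only zeros and entries of a - 1; the two padding matrices have natural entries. *)
Lemma rep_nat_affine (a : nat -> 'M[rat]_2) :
  (forall i j, nat_affine (fun k => (a k - 1%:M) i j)) ->
  forall i j, nat_affine (fun k => rep (a k) 1%:M i j).
Proof.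
move=> ha i j.
have embed_nat i' k' : exists c : nat, embed_mx i' k' = c%:R.
  rewrite mxE; case: ifP => _; last by eexists.
  by case/mxvec_indexP: k' => r s; rewrite mxvecE mxE; eexists.
have project_nat i' k' : exists c : nat, project_mx i' k' = c%:R by rewrite mxE; eexists.
have diff k : two_sided (a k) 1%:M - 1%:M = lin_mulmxr (a k - 1%:M).
  apply: eq_on_mxvec => X; rewrite mulmxBr mul_two_sided invmx1 mul1mx mulmx1.
  by rewrite mul_vec_lin /= mulmxBr mulmx1 linearB.
pose h k := (i == j)%:R +
  \sum_l (\sum_l' embed_mx i l' * lin_mulmxr (a k - 1%:M) l' l) * project_mx l j.
apply: (@eq_nat_affine h) => [k|].
  rewrite /rep diff /h !mxE; congr (_ + _); apply: eq_bigr => l _; congr (_ * _).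
  by rewrite mxE.
apply: nat_affine_add; first exact: nat_affine_const.
apply: nat_affine_sum => l; have [d ->] := project_nat l j.
apply: (@eq_nat_affine (fun k => d%:R * \sum_l' embed_mx i l' * lin_mulmxr (a k - 1%:M) l' l)).
  by move=> k; rewrite mulrC.
apply: nat_affine_mul; apply: nat_affine_sum => l'; have [c ->] := embed_nat i l'.
apply: nat_affine_mul.
case/mxvec_indexP: l' => r s; case/mxvec_indexP: l => r' s'.
apply: (@eq_nat_affine (fun k => (r == r')%:R * (a k - 1%:M) s s')).
  move=> k; rewrite /lin_mulmxr /lin_mx [RHS]mxE /= vec_mx_delta mxvecE.
  rewrite [RHS]mxE (bigD1 s) //= big1 => [|q /negbTE hq].
    by rewrite [delta_mx _ _ _ _]mxE eqxx andbT addr0 eq_sym.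
  by rewrite mxE hq andbF mul0r.
by have := nat_affine_mul (r == r') (ha s s').
Qed.

End Representation.

(** * The matrix of the input pair *)

Lemma eval_x_power n : eval (x_power n) = parabolic 0 n%:R.
Proof.
elim: n => [|n IH]; first by rewrite parabolic0.
rewrite -[x_power n.+1]/((Some (false, bX), true) :: x_power n) eval_cons IH.
by rewrite /letter_mx /letter_pos eqxx mulr0 parabolicD -natr1 addrC.
Qed.

Lemma eval_input_pair k :
  eval (input_pair k).1 = mx2 6 25 (5 + 6 * k)%:R (21 + 25 * k)%:R.
Proof.
rewrite eval_cat eval_x_power [eval (winv _)]mulmx1 /letter_mx.
rewrite (_ : letter_pos _ = -1) // mx2M (natrD _ 5) (natrD _ 21) (natrM _ 6) (natrM _ 25) -natr1.
by congr mx2; rewrite /sign /= ?expr0n /=; ring.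
Qed.

Lemma input_pair_nat_affine i j : nat_affine (fun k => (eval (input_pair k).1 - 1%:M) i j).
Proof.
have e k : eval (input_pair k).1 - 1%:M = mx2 5 25 (5 + 6 * k)%:R (20 + 25 * k)%:R.
  rewrite eval_input_pair -mx2_1 [LHS]mx2_eta !mxE /= (natrD _ 21) (natrD _ 20) !subr0.
  by congr mx2; ring.
apply: (@eq_nat_affine (fun k => mx2 5 25 (5 + 6 * k)%:R (20 + 25 * k)%:R i j)) => [k|].
  by rewrite e.
case: i j => [[|[|//]] ?] [[|[|//]] ?].
- by exists 5%N, 0%N => k; rewrite mxE.
- by exists 25%N, 0%N => k; rewrite mxE.
- by exists 5%N, 6%N => k; rewrite mxE.
- by exists 20%N, 25%N => k; rewrite mxE.
Qed.

(** * Reduction of halting to the corner problem *)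

Section Reduction.

Variables (n : nat) (n_gt5 : (5 < n.+1)%N).

Definition rep_pair (vw : word * word) : 'M[rat]_n.+1 := rep n (eval vw.1) (eval vw.2).

Definition machine_matrices (p : seq instr) : seq 'M[rat]_n.+1 := map rep_pair (machine_pairs p).

Lemma rep_eval_unit v w : rep n (eval v) (eval w) \in unitmx.
Proof. by have [] := rep_unit n_gt5 (eval_unit v) (eval_unit w). Qed.

Lemma reduction p N :
  has_nontrivial_corner_zero (rep_pair (input_pair N) :: machine_matrices p) <-> accepts p 0 N.
Proof.
rewrite -[_ :: _]/(map rep_pair (input_pair N :: machine_pairs p)).
set P := _ :: machine_pairs p; split.
  move=> [A [gen [A1 corner]]].
  have [v [w [gvw eA]]] : exists v w, generated P v w /\ A = rep_pair (v, w).
    (* The generated subgroup is the least one containing the list, and the images of generated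
       pairs of words form a subgroup containing it. *)
    apply: (gen (fun A => exists v w, generated P v w /\ A = rep_pair (v, w))); last first.
      by move=> B /mapP[[v w] mem ->]; exists v, w; split=> //; exact: generated_base.
    split.
    - by move=> _ [v [w [_ ->]]]; exact: rep_eval_unit.
    - by exists [::], [::]; split; [exact: generated_one | rewrite /rep_pair rep1].
    - move=> _ _ [v [w [g ->]]] [v' [w' [g' ->]]]; exists (v ++ v'), (w ++ w').
      by split; [exact: generated_cat | rewrite /rep_pair !eval_cat repM // eval_unit].
    - move=> _ [v [w [g ->]]]; exists (winv v), (winv w); split; first exact: generated_winv.
      by rewrite /rep_pair !eval_winvE; have [] := rep_unit n_gt5 (eval_unit v) (eval_unit w).
  apply/decbP; apply: contraT => /decbP nacc.
  move: corner; rewrite eA rep_corner // => corner.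
  have [e1 e2] := soundness nacc gvw corner.
  by move: A1; rewrite eA /rep_pair /= e1 e2 rep1 eqxx.
move=> acc.
pose G (a b : unit_mx2) := in_generated (map rep_pair P) (rep n (unit_mx2_val a) (unit_mx2_val b)).
have GP v w : (v, w) \in P -> G (geval v) (geval w).
  by move=> mem S _; apply; apply/mapP; exists (v, w).
have Gf : G (geval f_word) (geval f_word).
  have memP v w : (v, w) \in machine_pairs p -> G (geval v) (geval w).
    by move=> h; apply: GP; rewrite inE h orbT.
  have mem_snd a : a \in [:: bX; bY] ++ [seq bT i | i <- iota 0 (size p).+1] ++
      [seq bR rho | rho <- rules p] -> G (geval (fst_word a)) (geval (snd_word a)).
    move=> h; apply: memP; rewrite /machine_pairs mem_cat; apply/orP; left.
    by apply/mapP; exists a.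
  have mem_f a : a \in bT (size p) :: [seq bR rho | rho <- rules p] ->
      G (geval (f_relator (fst_word a))) (geval [::]).
    move=> h; apply: memP; rewrite /machine_pairs !mem_cat.
    by do 3 (apply/orP; right); apply/orP; left; apply/mapP; exists a.
  have Glast : G (geval f_word) (geval (conj_word f_word
         (winv (conj_word (snd_word (bT 0)) (snd_word bY ++ winv (snd_word bX)))))).
    apply: memP; rewrite /machine_pairs !mem_cat; do 4 (apply/orP; right); exact: mem_head.
  apply: (@completeness unit_mx2 G _ _ _ (geval f_word) _ p N
    (geval (fst_word bX)) (geval (fst_word bY)) (geval (snd_word bX)) (geval (snd_word bY))
    (fun i => geval (fst_word (bT i))) (fun i => geval (snd_word (bT i)))
    (fun rho => geval (fst_word (bR rho))) (fun rho => geval (snd_word (bR rho)))).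
  - by move=> S [_ S1 _ _] _; rewrite /= rep1.
  - move=> a b c d ab cd S SG SX; have [_ _ SM _] := SG.
    rewrite /= repM ?unit_mx2P //; apply: SM; [exact: ab | exact: cd].
  - move=> a b ab S SG SX; have [_ _ _ SV] := SG.
    have [_ <-] := rep_unit n_gt5 (unit_mx2P a) (unit_mx2P b); apply: SV; exact: ab.
  - by eexists; exact: Glast.
  - by apply: mem_snd; rewrite mem_cat !inE eqxx.
  - by apply: mem_snd; rewrite mem_cat !inE eqxx.
  - by move=> i hi; apply: mem_snd; rewrite !mem_cat (map_f bT) ?orbT // mem_iota.
  - by move=> rho h; apply: mem_snd; rewrite !mem_cat (map_f bR h) !orbT.
  - move=> i m c j k d rho h; rewrite -geval_rule_relator_x -geval_nil; apply: memP.
    rewrite /machine_pairs !mem_cat; apply/orP; right; apply/orP; left.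
    by apply/mapP; exists rho.
  - move=> i m c j k d rho h; rewrite -geval_rule_relator_t -geval_nil; apply: memP.
    rewrite /machine_pairs !mem_cat; do 2 (apply/orP; right); apply/orP; left.
    by apply/mapP; exists rho.
  - rewrite -geval_relator -geval_nil; exact: mem_f (mem_head _ _).
  - move=> rho h; rewrite -geval_relator -geval_nil; apply: mem_f.
    by rewrite inE map_f ?orbT.
  - rewrite -geval_x_power -geval_winv -geval_cat -geval_nil.
    exact: GP (mem_head (input_pair N) (machine_pairs p)).
  - rewrite -geval_winv -geval_cat -geval_conj_word -geval_winv -geval_conj_word; exact: Glast.
  - exact: acc.
exists (rep_pair (f_word, f_word)); split; first exact: Gf.
split; last by rewrite rep_corner // mulVmx ?eval_unit // mxE.
(* This elementary matrix does not commute with the matrix of f, whose lower left entry is 1. *)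
apply: (rep_neq1 n_gt5 (X := mx2 0 1 0 0)).
rewrite -mulmxA; apply/eqP => /(congr1 (mulmx (eval f_word))).
rewrite mulKVmx ?eval_unit // {1 2}/eval /= /mx_sem mulmx1 /letter_mx /parabolic !mx2M.
move/matrixP/(_ 0 0); rewrite !mxE /=.
by rewrite !(mul0r, mulr0) add0r addr0 mulr1 => /eqP; rewrite oner_eq0.
Qed.

End Reduction.

Theorem theorem2 (n : nat) : (9 <= n)%N ->
  ~ machine_decidable (@GL_list n) (@has_nontrivial_corner_zero n).
Proof.
case: n => // n n9 [p hp].
have n_gt5 : (5 < n.+1)%N by exact: leq_trans n9.
have affine i j : nat_affine (fun k => rep_pair n (input_pair k) i j).
  exact: rep_nat_affine (fun i j => input_pair_nat_affine i j) i j.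
have [e he] := expressible_pickle_cons affine.
pose q := negated_machine e p; pose F := machine_matrices n q.
(* The parameter is 2^(pickle F) because [q] started on x = [pickle F] has the integer encoding
   2^x. *)
pose t := rep_pair n (input_pair (2 ^ pickle F)) :: F.
have red : has_nontrivial_corner_zero t <-> halts_on q (pickle F).
  by rewrite reduction // -halts_on_accepts.
have valid : GL_list t.
  by move=> A; rewrite inE => /orP[/eqP ->|/mapP[vw _ ->]]; exact: rep_eval_unit.
have [h1 h0] := hp t valid; rewrite -he in h1 h0.
have nP : ~ has_nontrivial_corner_zero t.
  by move=> h; apply: (negated_machine_loops (h1 h)); apply/red.
by apply: (nP); apply/red; apply: negated_machine_halts; exact: h0.
Qed.
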